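(* Let $J=2$. For all $\theta=(\nu,Q,(f_x)_{x\in\mathbb{X}})\in\Theta^{\mathrm{dep}}$ such that $\delta:=\min_{x,x'}Q_{x,x'}>0$ and $\min_x\nu_x\ge\delta$, and all $n\ge1$, $$(1-\tilde\alpha_n)\inf_{h\in\mathcal{H}_n}\mathcal{R}_n^{\mathrm{class}}(\theta,h)\le\inf_{g\in\mathcal{G}_n}\mathcal{R}_n^{\mathrm{clust}}(\theta,g)\le\inf_{h\in\mathcal{H}_n}\mathcal{R}_n^{\mathrm{class}}(\theta,h),$$ where $$\tilde\alpha_n=2e\left(\frac{1-\delta}{\delta}\right)^4\left[\frac{1-\delta}{\delta}\sqrt{\frac{\log 2}{2n}}\right]^{1-2/n}.$$
   Context: Model. $J\ge2$ is an integer, $\mathbb{X}=\{1,\dots,J\}$, $(\mathbb{Y},\mathcal{Y})$ is a Polish space with its Borel $\sigma$-field and $\mathcal{L}$ is a dominating ($\sigma$-finite) measure on it. A parameter is $\theta=(\nu,Q,(f_x)_{x\in\mathbb{X}})$ with $\nu$ a probability vector on $\mathbb{X}$, $Q$ a $J\times J$ transition matrix and $f_x$ probability densities with respect to $\mathcal{L}$. Under $\mathbb{P}_\theta$ (expectation $\mathbb{E}_\theta$), $(X_i)_{i\ge1}$ is a Markov chain on $\mathbb{X}$ with initial law $\nu$ and transition matrix $Q$ and, conditionally on $(X_i)_{i\ge 1}$, the $Y_i$ are independent, $Y_i$ having density $f_{X_i}$. $Y_{1:n}=(Y_1,\dots,Y_n)$. $\Theta^{\mathrm{dep}}$ is the set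 of parameters for which the rows of $Q$ are not all equal. Risks. $\mathcal{P}[n]$ is the set of partitions of $[n]=\{1,\dots,n\}$. $\mathcal{G}_n$ is the set of measurable maps $g:\mathbb{Y}^n\to\mathcal{P}[n]$ (clusterers) and $\mathcal{H}_n$ the set of measurable maps $h=(h_1,\dots,h_n):\mathbb{Y}^n\to\mathbb{X}^n$ (classifiers). $\Pi_n$ is the partition of $[n]$ into the nonempty sets among $\{i:X_i=x\}$, $x\in\mathbb{X}$. For partitions $A,B$ of $[n]$, $\ell(A,B)=1-\frac1n\sup_M\sum_{\{C,C'\}\in M}\mathrm{Card}(C\cap C')$, the supremum being over matchings $M$ between the blocks of $A$ and the blocks of $B$ in the complete bipartite graph (each block is in at most one edge). $\mathcal{R}_n^{\mathrm{clust}}(\theta,g)=\mathbb{E}_\theta[\ell(g(Y_{1:n}),\Pi_n)]$ and $\mathcal{R}_n^{\mathrm{class}}(\theta,h)=\mathbb{E}_\theta[\frac1n\sum_{i=1}^n\mathbf{1}_{h_i(Y_{1:n})\ne X_i}]$. *)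

(* Defs.v *)
From HB Require Import structures.
From mathcomp Require Export all_boot all_order all_algebra.
From mathcomp Require Export all_classical all_reals all_analysis.

Set Implicit Arguments.
Unset Strict Implicit.
Unset Printing Implicit Defensive.

Import Order.TTheory GRing.Theory Num.Theory.
Import numFieldNormedType.Exports.

Local Open Scope classical_set_scope.
Local Open Scope ring_scope.

(* Conventions: the state space {1, ..., J} is 'I_J, the index set {1, ..., n}
   is 'I_n, and the processes are indexed from 0 (X i stands for X_(i+1)). *)

(* A Polish space is carried by a complete pseudometric space that is Hausdorff
   (so that the pseudometric is a metric) and separable. *)
Definition polish_space (R : realType) (Y : completePseudoMetricType R) : Prop :=
  hausdorff_space Y /\ exists2 D : set Y, countable D & dense D.

Definition borel (R : realType) (Y : completePseudoMetricType R) :=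
  g_sigma_algebraType (@open Y).

(* Measurability of a map into a finite type, which carries the discrete
   sigma-algebra. *)
Definition measurable_to_fin (d : measure_display) (T : measurableType d)
    (F : finType) (g : T -> F) : Prop :=
  forall S : set F, measurable (g @^-1` S).

Record hmm_param (R : realType) (Y : completePseudoMetricType R)
    (L : {sigma_finite_measure set (borel Y) -> \bar R}) (J : nat) := HmmParam {
  init : 'rV[R]_J;
  trans : 'M[R]_J;
  dens : 'I_J -> borel Y -> R;
  init_ge0 : forall x, 0 <= init 0 x;
  init_sum1 : \sum_x init 0 x = 1;
  trans_ge0 : forall x x', 0 <= trans x x';
  trans_sum1 : forall x, \sum_x' trans x x' = 1;
  dens_measurable : forall x, measurable_fun [set: borel Y] (dens x);
  dens_ge0 : forall x y, 0 <= dens x y;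
  dens_int1 : forall x, (\int[L]_y (dens x y)%:E)%E = 1%E
}.

Section Model.
Context (R : realType) (Y : completePseudoMetricType R)
        (L : {sigma_finite_measure set (borel Y) -> \bar R}) (J : nat).
Implicit Type theta : hmm_param L J.

Definition Theta_dep theta : Prop :=
  exists x x' : 'I_J, row x (trans theta) <> row x' (trans theta).

(* All the entries are at most 1, so the default value 1 does not affect the
   minima. *)
Definition min_trans theta : R :=
  \big[Num.min/1]_(p : 'I_J * 'I_J) trans theta p.1 p.2.

Definition min_init theta : R := \big[Num.min/1]_(x : 'I_J) init theta 0 x.

Definition emission theta (x : 'I_J) (A : set (borel Y)) : \bar R :=
  (\int[L]_(y in A) (dens theta x y)%:E)%E.

Context (d : measure_display) (Omega : measurableType d)
        (P : probability Omega R).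
Implicit Types (X : nat -> Omega -> 'I_J) (Yo : nat -> Omega -> borel Y).

(* The sigma-algebra generated by the whole sequence X. *)
Definition sigma_of X : set (set Omega) :=
  <<s [set B | exists i (S : set 'I_J), B = X i @^-1` S] >>.

(* P plays the role of P_theta for the processes X and Yo.
   [hmm_markov] is P(X_(k+1) = x_(k+1) | X_0 = x_0, ..., X_k = x_k)
     = Q(x_k, x_(k+1)), multiplied out;
   [hmm_cond] says that the product of the emission laws of X_0, ..., X_(n-1)
   is a version of P(Yo_0 \in A_0, ..., Yo_(n-1) \in A_(n-1) | sigma(X)). *)
Record is_hmm theta X Yo : Prop := IsHmm {
  hmm_measX : forall i, measurable_to_fin (X i);
  hmm_measY : forall i, measurable_fun [set: Omega] (Yo i);
  hmm_init : forall x, P (X 0%N @^-1` [set x]) = (init theta 0 x)%:E;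
  hmm_markov : forall (k : nat) (x : nat -> 'I_J),
    P (\bigcap_(i in `I_k.+2) X i @^-1` [set x i])
    = (P (\bigcap_(i in `I_k.+1) X i @^-1` [set x i])
       * (trans theta (x k) (x k.+1))%:E)%E;
  hmm_cond : forall (n : nat) (B : set Omega) (A : nat -> set (borel Y)),
    sigma_of X B -> (forall i, measurable (A i)) ->
    P (B `&` \bigcap_(i in `I_n) Yo i @^-1` A i)
    = (\int[P]_(w in B) \prod_(i < n) emission theta (X i w) (A i))%E
}.

End Model.

Section Loss.
Context (n : nat).
Implicit Types A B : {set {set 'I_n}}.

Definition partitions : finType :=
  {A : {set {set 'I_n}} | finset.partition A [set: 'I_n]%SET}.

(* An edge {C, C'} with C in A and C' in B is the pair (C, C'), so that A and B
   are disjoint sides of the bipartite graph even if they share blocks. *)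
Definition is_matching A B (M : {set {set 'I_n} * {set 'I_n}}) : bool :=
  (M \subset finset.setX A B) &&
  [forall e in M, forall e' in M,
     (e != e') ==> (e.1 != e'.1) && (e.2 != e'.2)].

Definition loss (R : realType) A B : R :=
  1 - n%:R^-1 *
    (\max_(M | is_matching A B M) \sum_(e in M) #|e.1 :&: e.2|%SET)%N%:R.

Definition level_partition (J : nat) (x : 'I_n -> 'I_J) : {set {set 'I_n}} :=
  ([set [set i | x i == a] | a : 'I_J] :\ finset.set0)%SET.

End Loss.

Section Risks.
Context (R : realType) (Y : completePseudoMetricType R) (J : nat)
        (d : measure_display) (Omega : measurableType d)
        (P : probability Omega R)
        (X : nat -> Omega -> 'I_J) (Yo : nat -> Omega -> borel Y) (n : nat).

Definition observations (w : Omega) : n.-tuple (borel Y) :=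
  [tuple Yo i w | i < n].

Definition risk_clust (g : n.-tuple (borel Y) -> partitions n) : \bar R :=
  ('E_P[fun w => loss R (val (g (observations w)))
                        (level_partition (fun i : 'I_n => X i w))])%E.

Definition risk_class (h : n.-tuple (borel Y) -> n.-tuple 'I_J) : \bar R :=
  ('E_P[fun w => (n%:R^-1 *
     \sum_(i < n) (tnth (h (observations w)) i != X i w)%:R)%R])%E.

Definition inf_risk_clust : \bar R :=
  ereal_inf [set risk_clust g | g in [set g | measurable_to_fin g]].

Definition inf_risk_class : \bar R :=
  ereal_inf [set risk_class h | h in [set h | measurable_to_fin h]].

End Risks.

Definition alpha_tilde (R : realType) (delta : R) (n : nat) : R :=
  2 * expR 1 * ((1 - delta) / delta) ^+ 4 *
  ((1 - delta) / delta * Num.sqrt (ln 2 / (2 * n%:R))) `^ (1 - 2 / n%:R).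

(* Main.v *)
(* Fix the observations. Up to normalisation, the posterior law of the hidden
   states is the law of an inhomogeneous two-state Markov chain whose transition
   probabilities vary by a factor at most c^2 with the current state, where
   c = (1 - delta) / delta. Hence the number S of errors of any labelling, with
   marginal error probabilities q_i, satisfies
     Var S <= c^4 sum_i q_i (1 - q_i) <= c^4 rho,
   where rho = sum_i min(q_i, 1 - q_i) is n times the posterior Bayes risk; the
   first inequality is proved by induction along the chain (law of total
   variance and concavity of q (1 - q)).
   For a partition with largest blocks D1 and D2, let S1 and S2 be the numbers
   of errors of the labellings which separate D1, resp. D2, from the rest.
   Then n times the loss is at least min(S1, n - S1, n/3) and at least
   min(S1, n - S1, S2, n - S2, n/2), and Chebyshev-type estimates bound its mean
   below by (1 - alpha) rho as soon as alpha <= 1 and alpha^2 n >= 9 c^10, which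
   holds for alpha = alpha_tilde <= 1 because 2 e^2 log 2 >= 9; for alpha > 1 the
   lower bound is trivial.
   For the upper bound, the level sets of a classifier cluster at least as well. *)
From HB Require Import structures.
Require Import Defs.
From mathcomp Require Import measurable_realfun ring lra zify.
Import Order.TTheory GRing.Theory Num.Theory.
Import numFieldNormedType.Exports.
Local Open Scope ring_scope.

Set Implicit Arguments.
Unset Strict Implicit.
Unset Printing Implicit Defensive.

(** * Path sums and Markov chains *)

Section PathSum.
Context (R : realFieldType) (T : finType).
Implicit Types (ks : nat -> T -> T -> R) (F : seq T -> R) (a b : T).

(** Unnormalised expectation of [F] along an inhomogeneous chain started at [a], a state that [F]
    does not see. Peeling kernels off the front makes induction on [n] a conditioning on the first
    step. *)
Fixpoint path_sum n ks F a : R :=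
  if n is n'.+1 then
    \sum_b ks 0%N a b * path_sum n' (fun i => ks i.+1) (fun s => F (b :: s)) b
  else F [::].

Lemma eq_path_sum n ks F G a :
  (forall s, size s = n -> F s = G s) -> path_sum n ks F a = path_sum n ks G a.
Proof.
elim: n ks F G a => [|n IH] ks F G a FG /=; first exact: FG.
by apply: eq_bigr => b _; congr (_ * _); apply: IH => s sn; rewrite FG //= sn.
Qed.

Lemma path_sumD n ks F G a :
  path_sum n ks (fun s => F s + G s) a = path_sum n ks F a + path_sum n ks G a.
Proof.
elim: n ks F G a => [|n IH] ks F G a //=.
by rewrite -big_split; apply: eq_bigr => b _; rewrite IH mulrDr.
Qed.

Lemma path_sumZ n ks F r a :
  path_sum n ks (fun s => r * F s) a = r * path_sum n ks F a.
Proof.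
elim: n ks F a => [|n IH] ks F a //=.
by rewrite mulr_sumr; apply: eq_bigr => b _; rewrite IH mulrCA.
Qed.

Lemma path_sum_sum n ks (I : Type) (r : seq I) (F : I -> seq T -> R) a :
  path_sum n ks (fun s => \sum_(i <- r) F i s) a
  = \sum_(i <- r) path_sum n ks (F i) a.
Proof.
elim: r => [|i r IH].
  rewrite big_nil -[RHS](mul0r (path_sum n ks (fun=> 0) a)) -path_sumZ.
  by apply: eq_path_sum => s _; rewrite big_nil mul0r.
by rewrite big_cons -IH -path_sumD; apply: eq_path_sum => s _; rewrite big_cons.
Qed.

Lemma path_sum_ge0 n ks F a : (forall i a b, 0 <= ks i a b) ->
  (forall s, 0 <= F s) -> 0 <= path_sum n ks F a.
Proof.
elim: n ks F a => [|n IH] ks F a k0 F0 //=.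
by apply: sumr_ge0 => b _; rewrite mulr_ge0 // IH.
Qed.

(** Here [nth a (a :: t) i] is the state before step [i]; in this form a path sum is an ordinary
    weighted sum over a finite set. *)
Lemma path_sumE n ks F a :
  path_sum n ks F a = \sum_(t : n.-tuple T)
    (\prod_(i < n) ks i (nth a (a :: t) i) (nth a t i)) * F t.
Proof.
elim: n ks F a => [|n IH] ks F a /=.
  rewrite (big_pred1 [tuple]) => [|t]; first by rewrite big_ord0 mul1r.
  by apply/esym/eqP/val_inj; rewrite /= [t]tuple0.
rewrite (reindex (fun p : T * n.-tuple T => [tuple of p.1 :: p.2])) /=; last first.
  exists (fun t : n.+1.-tuple T => (thead t, [tuple of behead t])) => [[b t] _|t _] /=.
    by congr pair; apply: val_inj.
  by rewrite [RHS](tuple_eta t).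
rewrite -(pair_bigA _ (fun b (t : n.-tuple T) =>
  (\prod_(i < n.+1) ks i (nth a [:: a, b & t] i) (nth a (b :: t) i)) * F (b :: t))) /=.
apply: eq_bigr => b _; rewrite IH mulr_sumr; apply: eq_bigr => t _.
rewrite big_ord_recl /= mulrA; congr (_ * _ * _).
(* The two sides use the defaults [b] and [a], but every index is in range. *)
apply: eq_bigr => i _; rewrite /bump /= add1n.
by congr (ks _ _ _); [case: i => -[|i] //= ni; apply: set_nth_default|
  apply: set_nth_default]; rewrite size_tuple // ltnW.
Qed.

(** As [a] and [a'] can be exchanged, the current state influences the next one only up to a factor
    between [1 / c] and [c]. *)
Definition mixing (c : R) (k : T -> T -> R) : Prop :=
  forall a a' b, 0 <= k a b /\ k a b <= c * k a' b.

Definition stochastic (k : T -> T -> R) : Prop := forall a, \sum_b k a b = 1.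

Lemma path_sum_cst n ks r a : (forall i, stochastic (ks i)) ->
  path_sum n ks (fun=> r) a = r.
Proof.
elim: n ks a => [|n IH] ks a kst //=.
by under eq_bigr => b _ do rewrite IH //; rewrite -mulr_suml kst mul1r.
Qed.

(* Doob's h-transform by the total masses of the remaining path sums; a zero
   mass makes all the path sums vanish, so the kernel is then irrelevant. *)
Lemma path_sum_normalize n ks c : 1 <= c -> (forall i, mixing c (ks i)) ->
  exists qs, [/\ forall i, stochastic (qs i), forall i, mixing (c ^+ 2) (qs i) &
    forall F a, path_sum n ks F a = path_sum n ks (fun=> 1) a * path_sum n qs F a].
Proof.
move=> c1; have c0 : 0 <= c by apply: le_trans c1.
case: (pickP (@predT T)) => [a0 _|noT]; last first.
  move=> _; exists (fun _ _ _ => 0); split=> [i a|i a|F a]; by have := noT a.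
have trivial_st : stochastic (fun _ b => (b == a0)%:R).
  move=> a; rewrite (bigD1 a0) //= eqxx big1 ?addr0 // => b /negPf -> //.
have trivial_mix : mixing (c ^+ 2) (fun _ b => (b == a0)%:R).
  by move=> a a' b; rewrite ler0n ler_peMl ?ler0n // exprn_ege1.
elim: n ks => [|n IH] ks kmix.
  by exists (fun=> fun _ b => (b == a0)%:R); split=> // F a; rewrite mul1r.
have [qs [qst qmix qE]] := IH (fun i => ks i.+1) (fun i => kmix i.+1).
pose Z' := path_sum n (fun i => ks i.+1) (fun=> 1).
pose Z := path_sum n.+1 ks (fun=> 1).
have Z'0 b : 0 <= Z' b by apply: path_sum_ge0 => // i x y; have [] := kmix i.+1 x x y.
have k0 a b : 0 <= ks 0%N a b by have [] := kmix 0%N a a b.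
(* The total masses inherit the constant [c] from the first kernel alone. *)
have Zle a a' : Z a <= c * Z a'.
  rewrite /Z /= mulr_sumr ler_sum // => b _.
  by rewrite mulrA ler_wpM2r //; have [] := kmix 0%N a a' b.
have Z0 a : 0 <= Z a by apply: sumr_ge0 => b _; rewrite mulr_ge0.
pose q a b := if Z a == 0 then (b == a0)%:R else ks 0%N a b * Z' b / Z a.
exists (fun i => if i is j.+1 then qs j else q); split=> [[|i]//|[|i]//|F a].
- move=> a; rewrite /q; case: eqP => [_|/eqP Za0]; first exact: trivial_st.
  by rewrite -mulr_suml -/(path_sum n.+1 ks (fun=> 1) a) divff.
- move=> a a' b; rewrite /q; case: eqP => [Za|/eqP Za].
    have -> : Z a' == 0 by rewrite eq_le Z0 andbT (le_trans (Zle _ a)) // Za mulr0.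
    exact: trivial_mix.
  have Zap : 0 < Z a by rewrite lt0r Za Z0.
  have -> : (Z a' == 0) = false.
    apply: contraTF (Zap) => /eqP Za'; rewrite -leNgt.
    by rewrite (le_trans (Zle _ a')) // Za' mulr0.
  have Za'p : 0 < Z a'.
    have := Zle a a'; have := Z0 a'.
    by rewrite le_eqVlt => /orP[/eqP <-|//]; rewrite mulr0 leNgt Zap.
  split; first by rewrite divr_ge0 // mulr_ge0.
  (* One factor [c] comes from the kernel, the other from the ratio of the masses [Z a] and
     [Z a']. *)
  rewrite ler_pdivrMr // [X in _ <= X](_ : _ =
    (c * ks 0%N a' b) * Z' b * (c * Z a / Z a')); last by field; rewrite gt_eqF.
  rewrite -[X in X <= _]mulr1 ler_pM ?mulr_ge0 //.
    by rewrite ler_wpM2r //; have [] := kmix 0%N a a' b.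
  by rewrite ler_pdivlMr // mul1r.
- rewrite -/(Z a) /= /q mulr_sumr; apply: eq_bigr => b _.
  rewrite qE -/(Z' b) mulrA; case: eqP => [Za|/eqP Za].
    rewrite Za mul0r.
    have /eqP : Z a = 0 by [].
    rewrite /Z /= psumr_eq0 => [|b' _]; last by rewrite mulr_ge0.
    by move=> /allP/(_ b (mem_index_enum _))/eqP ->; rewrite mul0r.
  by rewrite !mulrA; congr (_ * _); field.
Qed.

End PathSum.

(** * Mean and variance of the number of errors along a two-state chain *)

Section BinaryChain.
Context (R : realFieldType).
Implicit Types (ks : nat -> 'I_2 -> 'I_2 -> R) (h : nat -> 'I_2) (a b : 'I_2).

Lemma big_ord2 (F : 'I_2 -> R) : \sum_b F b = F ord0 + F ord_max.
Proof.
by rewrite big_ord_recl big_ord_recl big_ord0 addr0; congr (_ + F _); apply: val_inj.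
Qed.

Lemma ord2_ind (P : 'I_2 -> Prop) : P ord0 -> P ord_max -> forall b, P b.
Proof.
move=> P0 P1 b; have [->|b0] := eqVneq b ord0; first exact: P0.
rewrite (_ : b = ord_max) //; apply: val_inj.
by case: b b0 => [[|[|b]] lt_b].
Qed.

(** The bias-variance identity; applied to the tail of the chain it yields the law of total
    variance. *)
Lemma path_sum_sqrD (T : finType) n (ks : nat -> T -> T -> R) F r x :
  (forall i, stochastic (ks i)) ->
  path_sum n ks (fun s => (F s + r) ^+ 2) x =
  path_sum n ks (fun s => (F s - path_sum n ks F x) ^+ 2) x +
  (path_sum n ks F x + r) ^+ 2.
Proof.
move=> kst; set m := path_sum n ks F x.
have sqrE y : path_sum n ks (fun s => (F s + y) ^+ 2) x =
    path_sum n ks (fun s => F s ^+ 2) x + (2 * y * m + y ^+ 2).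
  rewrite -[y ^+ 2 in RHS](path_sum_cst n _ x kst) -path_sumZ -!path_sumD.
  by apply: eq_path_sum => s _; ring.
by rewrite !sqrE; ring.
Qed.

(** Indexing [h] by [nat] turns passage to the tail of the chain into the shift [h i.+1]. *)
Definition mismatches n h (s : seq 'I_2) : R :=
  \sum_(i < n) (nth ord0 s i != h i)%:R.

Definition mismatch_prob n ks h a i : R :=
  path_sum n ks (fun s => (nth ord0 s i != h i)%:R) a.

Lemma path_sum_mismatches n ks h a :
  path_sum n ks (mismatches n h) a = \sum_(i < n) mismatch_prob n ks h a i.
Proof. exact: path_sum_sum. Qed.

Lemma mismatches_cons n h b s :
  mismatches n.+1 h (b :: s) = (b != h 0%N)%:R + mismatches n (fun i => h i.+1) s.
Proof. by rewrite /mismatches big_ord_recl. Qed.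

Lemma path_sum_mismatchesS n ks h a : (forall i, stochastic (ks i)) ->
  path_sum n.+1 ks (mismatches n.+1 h) a =
  \sum_b ks 0%N a b * ((b != h 0%N)%:R +
    path_sum n (fun i => ks i.+1) (mismatches n (fun i => h i.+1)) b).
Proof.
move=> kst /=; apply: eq_bigr => b _; congr (_ * _).
rewrite -[X in X + _](path_sum_cst n _ b (fun i => kst i.+1)) -path_sumD.
by apply: eq_path_sum => s _; rewrite mismatches_cons.
Qed.

(* The sensitivity D of the mean to the starting state satisfies
   D <= (1 - 1/c) (1 + D'), whose fixed point is c - 1. *)
Lemma mismatches_mean_osc n ks h c : 1 <= c ->
  (forall i, stochastic (ks i)) -> (forall i, mixing c (ks i)) ->
  `|path_sum n ks (mismatches n h) ord_max - path_sum n ks (mismatches n h) ord0|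
  <= c - 1.
Proof.
move=> c1; elim: n ks h => [|n IH] ks h kst kmix.
  by rewrite /= subrr normr0 subr_ge0.
have := IH _ (fun i => h i.+1) (fun i => kst i.+1) (fun i => kmix i.+1).
rewrite !path_sum_mismatchesS // !big_ord2.
set m0 := path_sum _ _ _ ord0; set m1 := path_sum _ _ _ ord_max => mm.
have := kst 0%N ord0; have := kst 0%N ord_max; rewrite !big_ord2.
have [] := kmix 0%N ord0 ord_max ord0; have [] := kmix 0%N ord_max ord0 ord0.
have [] := kmix 0%N ord0 ord_max ord_max; have [] := kmix 0%N ord_max ord0 ord_max.
move: (ks 0%N) => k.
set x00 := k ord0 ord0; set x01 := k ord0 ord_max.
set x10 := k ord_max ord0; set x11 := k ord_max ord_max.
move=> p11 l11 p01 l01 p10 l10 p00 l00 s1 s0.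
set f0 := (_ != _)%:R; set f1 := (ord_max != _)%:R.
pose g := f1 + m1 - (f0 + m0).
have -> : x10 * (f0 + m0) + x11 * (f1 + m1) - (x00 * (f0 + m0) + x01 * (f1 + m1))
    = (x11 - x01) * g.
  have -> : x10 = 1 - x11 by lra.
  have -> : x00 = 1 - x01 by lra.
  by rewrite /g; ring.
have fl : `|f1 - f0| <= 1 by rewrite /f0 /f1; do 2 case: (_ == _) => /=;
  rewrite ?subrr ?subr0 ?sub0r ?normrN ?normr0 ?normr1.
have gl : `|g| <= c.
  rewrite (_ : g = (f1 - f0) + (m1 - m0)); last by rewrite /g; ring.
  by apply: le_trans (ler_normD _ _) _; lra.
rewrite normrM.
(* From [x11 <= c * x01] follows [c * (x11 - x01) <= (c - 1) * x11 <= c - 1]; the other sign is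
   symmetric, with the complementary entries. *)
have kl : `|x11 - x01| * c <= c - 1.
  have : 0 <= (c - 1) * (1 - x11) by rewrite mulr_ge0 //; lra.
  have : 0 <= (c - 1) * (1 - x01) by rewrite mulr_ge0 //; lra.
  by have [_|_] := ger0P (x11 - x01); lra.
by apply: le_trans kl; rewrite ler_wpM2l.
Qed.

(** The constant is the square of the gap between the two conditional means given the first state:
    at most 1 from the first site plus [c - 1] from the rest. *)
Lemma variance_mismatches_le n ks h c a : 1 <= c ->
  (forall i, stochastic (ks i)) -> (forall i, mixing c (ks i)) ->
  path_sum n ks (fun s =>
    (mismatches n h s - path_sum n ks (mismatches n h) a) ^+ 2) a
  <= c ^+ 2 * \sum_(i < n) mismatch_prob n ks h a i * (1 - mismatch_prob n ks h a i).
Proof.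
move=> c1; elim: n ks h a => [|n IH] ks h a kst kmix.
  by rewrite /mismatches /= !big_ord0 mulr0 subrr expr0n.
set ks' := fun i => ks i.+1; set h' := fun i => h i.+1.
have kst' i : stochastic (ks' i) by exact: kst.
have kmix' i : mixing c (ks' i) by exact: kmix.
have k0 b : 0 <= ks 0%N a b by have [] := kmix 0%N a a b.
pose m' := path_sum n ks' (mismatches n h').
pose g b := (b != h 0%N)%:R + m' b.
have mE : path_sum n.+1 ks (mismatches n.+1 h) a = \sum_b ks 0%N a b * g b.
  exact: path_sum_mismatchesS.
rewrite {}mE; set m := \sum_b _ * g b.
have -> : path_sum n.+1 ks (fun s => (mismatches n.+1 h s - m) ^+ 2) a =
  \sum_b ks 0%N a b * path_sum n ks' (fun s => (mismatches n h' s - m' b) ^+ 2) b +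
  \sum_b ks 0%N a b * (g b - m) ^+ 2.
  rewrite -big_split; apply: eq_bigr => b _ /=; rewrite -mulrDr; congr (_ * _).
  have -> : g b - m = m' b + ((b != h 0%N)%:R - m) by rewrite /g addrAC addrC.
  rewrite -path_sum_sqrD //.
  by apply: eq_path_sum => s _; rewrite mismatches_cons; congr (_ ^+ 2); rewrite addrAC addrC.
(* The variance of the conditional mean is charged to site 0, the mean of the conditional variances
   to the later sites. *)
rewrite [X in _ <= _ * X]big_ord_recl mulrDr addrC; apply: lerD.
  have q0 : mismatch_prob n.+1 ks h a 0 = \sum_b ks 0%N a b * (b != h 0%N)%:R.
    rewrite /mismatch_prob /=; apply: eq_bigr => b _.
    by rewrite path_sum_cst.
  rewrite q0 /m !big_ord2.
  have := kst 0%N a; rewrite big_ord2.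
  have := k0 ord0; have := k0 ord_max.
  set x := ks 0%N a ord0; set y := ks 0%N a ord_max => y0 x0 xy.
  have -> : x = 1 - y by lra.
  have gl : `|g ord_max - g ord0| <= c.
    rewrite /g opprD addrACA; apply: le_trans (ler_normD _ _) _.
    rewrite (_ : c = 1 + (c - 1)); last by ring.
    apply: lerD; last exact: mismatches_mean_osc.
    by do 2 case: (_ == _) => /=; rewrite ?subrr ?subr0 ?sub0r ?normrN ?normr0 ?normr1.
  have -> : (1 - y) * (g ord0 - ((1 - y) * g ord0 + y * g ord_max)) ^+ 2 +
      y * (g ord_max - ((1 - y) * g ord0 + y * g ord_max)) ^+ 2 =
      (g ord_max - g ord0) ^+ 2 * (y * (1 - y)) by ring.
  (* The error probability at site 0 is [y] or [1 - y] according to [h 0]. *)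
  have -> : ((1 - y) * (ord0 != h 0%N)%:R + y * (ord_max != h 0%N)%:R) *
      (1 - ((1 - y) * (ord0 != h 0%N)%:R + y * (ord_max != h 0%N)%:R)) = y * (1 - y).
    by move: (h 0%N); apply: ord2_ind; rewrite /= ?eqxx /=; ring.
  apply: ler_wpM2r; first by nra.
  by rewrite -real_normK ?num_real // ler_sqr ?nnegrE // (le_trans _ c1).
apply: le_trans (_ : \sum_b ks 0%N a b * (c ^+ 2 * \sum_(i < n)
   mismatch_prob n ks' h' b i * (1 - mismatch_prob n ks' h' b i)) <= _).
  by apply: ler_sum => b _; rewrite ler_wpM2l // IH.
rewrite big_ord2 [X in X <= _](_ : _ = c ^+ 2 * \sum_(i < n) \sum_b
  ks 0%N a b * (mismatch_prob n ks' h' b i * (1 - mismatch_prob n ks' h' b i))); last first.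
  rewrite exchange_big /= big_ord2 -!mulr_sumr; ring.
apply: ler_wpM2l; first exact: sqr_ge0.
apply: ler_sum => i _; rewrite big_ord2.
have -> : mismatch_prob n.+1 ks h a (lift ord0 i) =
    \sum_b ks 0%N a b * mismatch_prob n ks' h' b i by [].
rewrite big_ord2; have := kst 0%N a; rewrite big_ord2.
have := k0 ord0; have := k0 ord_max.
set x := ks 0%N a ord0; set y := ks 0%N a ord_max => y0 x0 xy.
have -> : x = 1 - y by lra.
move: (mismatch_prob _ _ _ _ _) (mismatch_prob _ _ _ _ _) => u v.
(* This is the gap in Jensen's inequality for q (1 - q). *)
rewrite -subr_ge0 [X in 0 <= X](_ : _ = y * (1 - y) * (u - v) ^+ 2); last by ring.
by rewrite mulr_ge0 ?sqr_ge0 // mulr_ge0 //; lra.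
Qed.

End BinaryChain.

(** * Matchings and the clustering loss *)

Section Matching.
Context (n : nat).
Implicit Types (A : {set {set 'I_n}}) (C D : {set 'I_n}).

Lemma disjoint_cardsU C D : [disjoint C & D] -> (#|C :|: D|%SET = #|C| + #|D|)%N.
Proof. by move=> CD; apply/eqP; rewrite (leq_card_setU C D). Qed.

Definition level (x : 'I_n -> 'I_2) (a : 'I_2) : {set 'I_n} := [set i | x i == a]%SET.

(** Which side receives [ord0] is immaterial: error counts [S] and [n - S] always occur together. *)
Definition side_label D (i : 'I_n) : 'I_2 := if i \in D then ord0 else ord_max.

Definition side_errors D (x : 'I_n -> 'I_2) : nat := \sum_(i < n) (x i != side_label D i).

(** Two level sets allow at most two edges. [C0] and [C1] are the blocks matched with them; an
    unmatched level gets the empty set, hence [finset.set0 |: A]. *)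
Lemma matching_level_le A (x : 'I_n -> 'I_2) M :
  finset.partition A [set: 'I_n]%SET -> is_matching A (level_partition x) M ->
  exists C0 C1, [/\ C0 \in (finset.set0 |: A)%SET, C1 \in (finset.set0 |: A)%SET,
    [disjoint C0 & C1] &
    (\sum_(e in M) #|e.1 :&: e.2|%SET <=
      #|(C0 :&: level x ord0) :|: (C1 :&: level x ord_max)|%SET)%N].
Proof.
move=> /and3P[_ /finset.trivIsetP tA _] /andP[/fintype.subsetP MAB /forall_inP MM].
have Mdis e e' : e \in M -> e' \in M -> (e.1 == e'.1) || (e.2 == e'.2) -> e = e'.
  move=> eM e'M; apply: contraTeq => ne.
  by have /forall_inP/(_ _ e'M) := MM _ eM; rewrite ne => /andP[/negPf -> /negPf ->].
have levM e : e \in M -> e.1 \in A /\ exists2 a, e.2 = level x a & level x a != finset.set0.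
  move=> /MAB; rewrite finset.inE => /andP[e1 /setD1P[e2 /imsetP[a _ e2E]]].
  by split=> //; exists a => //; rewrite /level -e2E.
pose C a := if [pick e in M | e.2 == level x a] is Some e then e.1 else finset.set0.
have CA a : C a \in (finset.set0 |: A)%SET.
  rewrite /C; case: pickP => [e /andP[/levM[eA _] _]|_]; by rewrite !finset.inE ?eqxx // eA orbT.
have sumC a : (\sum_(e in M | e.2 == level x a) #|e.1 :&: e.2|%SET <= #|C a :&: level x a|%SET)%N.
  rewrite /C; case: pickP => [e /andP[eM /eqP e2]|none]; last first.
    by rewrite big_pred0 // finset.set0I cards0.
  rewrite (big_pred1 e) ?e2 // => e' /=; apply/andP/eqP => [[e'M /eqP e'2]|->].
    by apply: Mdis => //; rewrite e'2 e2 eqxx orbT.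
  by rewrite eM e2 eqxx.
have lev01 : [disjoint level x ord0 & level x ord_max].
  rewrite finset.disjoints_subset; apply/fintype.subsetP => i; rewrite !finset.inE => /eqP ->.
  by [].
exists (C ord0), (C ord_max); split=> //.
  rewrite /C; case: pickP => [e /andP[eM /eqP e2]|_]; last first.
    by rewrite finset.disjoints_subset finset.sub0set.
  case: pickP => [e' /andP[e'M /eqP e'2]|_]; last first.
    by rewrite disjoint_sym finset.disjoints_subset finset.sub0set.
  have [eA [a e2a lev0]] := levM e eM; have [e'A _] := levM e' e'M.
  apply: tA => //; apply/eqP => e1.
  (* A block shared by the two edges would make them equal, so that a nonempty level set would be
     disjoint from itself. *)
  have ee' : e = e' by apply: Mdis => //; rewrite e1 eqxx.
  move: lev01; rewrite -e2 -e'2 ee' -finset.setI_eq0 finset.setIid -ee' e2a.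
  by rewrite (negPf lev0).
rewrite disjoint_cardsU; last first.
  apply: disjointWl (finset.subsetIr _ _) _; apply: disjointWr (finset.subsetIr _ _) _.
  exact: lev01.
apply: leq_trans (leq_add (sumC ord0) (sumC ord_max)).
rewrite -!big_filter_cond [X in (_ <= X + _)%N]big_mkcond [X in (_ <= _ + X)%N]big_mkcond /=.
rewrite -big_split /= big_filter; apply: leq_sum => e eM.
have [_ [a -> _]] := levM e eM.
by move: a; apply: ord2_ind; rewrite eqxx ?leq_addr ?leq_addl.
Qed.

Lemma side_errorsE D x : side_errors D x = #|[set i | x i != side_label D i]%SET|.
Proof. by rewrite -sum1dep_card [RHS]big_mkcond; apply: eq_bigr => i _; case: (_ == _). Qed.

Lemma side_errors_compl D x : (#|[set i | x i == side_label D i]%SET| + side_errors D x = n)%N.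
Proof.
rewrite side_errorsE -[RHS](card_ord n) -(cardsC [set i | x i == side_label D i]%SET).
by congr (_ + _)%N; apply: eq_card => i; rewrite !finset.inE.
Qed.

(* D1 and D2 are the two largest blocks: a matched pair of blocks containing
   neither of them covers at most half of the points, and one not containing D1
   at most two thirds. *)
Lemma matching_two_blocks A : finset.partition A [set: 'I_n]%SET ->
  exists D1 D2, forall (x : 'I_n -> 'I_2) M, is_matching A (level_partition x) M ->
  let s := (\sum_(e in M) #|e.1 :&: e.2|%SET)%N in
  let near D := (s + side_errors D x <= n)%N || (s <= side_errors D x)%N in
  (near D1 \/ (3 * s <= 2 * n)%N) /\ [\/ near D1, near D2 | (2 * s <= n)%N].
Proof.
move=> pA; have /and3P[_ /finset.trivIsetP tA _] := pA.
have disjA C D : C \in (finset.set0 |: A)%SET -> D \in (finset.set0 |: A)%SET ->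
    C != D -> [disjoint C & D].
  rewrite !finset.inE => /orP[/eqP -> _ _|CA]; first by rewrite finset.disjoints_subset finset.sub0set.
  by move=> /orP[/eqP -> _|DA]; [rewrite disjoint_sym finset.disjoints_subset finset.sub0set|exact: tA].
have A0 : (finset.set0 : {set 'I_n}) \in (finset.set0 |: A)%SET by rewrite !finset.inE eqxx.
(* Adjoining the empty set covers partitions with fewer than two blocks. *)
have [D1 D1A D1max] := @arg_maxnP _ finset.set0
  (mem (finset.set0 |: A)%SET) (fun C : {set 'I_n} => #|C|) A0.
have [//=|D2 /andP[D2A D21] D2max] := @arg_maxnP _ finset.set0
  (fun C => (C \in (finset.set0 |: A)%SET) && [disjoint C & D1]) (fun C : {set 'I_n} => #|C|).
  by rewrite A0 finset.disjoints_subset finset.sub0set.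
exists D1, D2 => x M MA s near.
have [C0 [C1 [C0A C1A C01 sle]]] := matching_level_le pA MA.
set U := (_ :|: _)%SET in sle.
(* If [D] is [C0], all covered points are labelled correctly by [side_label D]; if [D] is [C1], all
   of them are labelled wrongly. *)
have nearD D : D \in (finset.set0 |: A)%SET -> (C0 == D) || (C1 == D) -> near D.
  move=> DA CD; apply/orP; case/orP: CD => /eqP CD; [left|right].
    rewrite -[X in (_ <= X)%N](side_errors_compl D x) leq_add2r (leq_trans sle) //.
    apply/subset_leq_card/fintype.subsetP => i; rewrite !finset.inE.
    rewrite /side_label => /orP[/andP[iC iB]|/andP[iC iB]].
      by rewrite -CD iC.
    have /negPf -> // : i \notin D.
    by rewrite -CD; move: iC; apply: contraL => iC0; rewrite (disjointFr C01).
  rewrite side_errorsE (leq_trans sle) //.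
  apply/subset_leq_card/fintype.subsetP => i; rewrite !finset.inE.
  rewrite /side_label => /orP[/andP[iC /eqP ->]|/andP[iC /eqP ->]].
    have /negPf -> // : i \notin D.
    by rewrite -CD (disjointFr C01).
  by rewrite -CD iC.
have sC : (s <= #|C0| + #|C1|)%N.
  apply: leq_trans sle _; rewrite finset.cardsU (leq_trans (leq_subr _ _)) //.
  by rewrite leq_add // subset_leq_card // finset.subsetIl.
have [CD1|/norP[C0D1 C1D1]] := boolP ((C0 == D1) || (C1 == D1)).
  by have n1 := nearD _ D1A CD1; split; [left|apply: Or31].
have d0 := disjA _ _ C0A D1A C0D1; have d1 := disjA _ _ C1A D1A C1D1.
have le0 : (#|C0| <= #|D1|)%N by exact: D1max.
have le1 : (#|C1| <= #|D1|)%N by exact: D1max.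
have le2 : (#|D2| <= #|D1|)%N by exact: D1max.
have le02 : (#|C0| <= #|D2|)%N by apply: D2max; rewrite C0A.
have le12 : (#|C1| <= #|D2|)%N by apply: D2max; rewrite C1A.
have card3 : (#|C0| + #|C1| + #|D1| <= n)%N.
  rewrite -[X in (_ <= X)%N]card_ord -(disjoint_cardsU C01).
  rewrite -disjoint_cardsU ?max_card //.
  by rewrite finset.disjoints_subset finset.subUset -!finset.disjoints_subset d0.
(* Without [D1], the pair is disjoint from a block at least as large as each of its members; without
   [D2] either, from two such blocks. *)
split.
  right; move: sC le0 le1 card3; clear.
  by move: #|C0| #|C1| #|D1| s => *; lia.
have [CD2|/norP[C0D2 C1D2]] := boolP ((C0 == D2) || (C1 == D2)).
  by apply: Or32; exact: nearD.
apply: Or33.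
have e0 := disjA _ _ C0A D2A C0D2; have e1 := disjA _ _ C1A D2A C1D2.
have card4 : (#|C0| + #|C1| + #|D1| + #|D2| <= n)%N.
  rewrite -[X in (_ <= X)%N]card_ord -(disjoint_cardsU C01).
  rewrite -disjoint_cardsU; last first.
    by rewrite finset.disjoints_subset finset.subUset -!finset.disjoints_subset d0.
  rewrite -disjoint_cardsU ?max_card //.
  by rewrite finset.disjoints_subset !finset.subUset -!finset.disjoints_subset e0 e1 disjoint_sym.
move: sC le02 le12 le2 card4; clear.
by move: #|C0| #|C1| #|D1| #|D2| s => *; lia.
Qed.

End Matching.

(** * The pointwise posterior inequality *)

Section FoldedLoss.
Context (R : realFieldType) (T : finType) (p : T -> R).
Hypotheses (p0 : forall x, 0 <= p x) (p1 : \sum_x p x = 1).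

Local Notation E F := (\sum_x p x * F x).
Local Notation V S := (\sum_x p x * (S x - E S) ^+ 2).

(** Turns a pointwise quadratic minorant of [Z] into a bound by means and variances; each regime
    below only has to choose the four coefficients. *)
Lemma expectation_quadratic_le (Z S1 S2 : T -> R) a b k1 k2 :
  (forall x, a + b * S1 x - k1 * (S1 x - E S1) ^+ 2 - k2 * (S2 x - E S2) ^+ 2 <= Z x) ->
  a + b * E S1 - k1 * V S1 - k2 * V S2 <= E Z.
Proof.
move=> le_Z; rewrite -[a]mulr1 -p1 !mulr_sumr -big_split -!sumrB /=.
by apply: ler_sum => x _; apply: le_trans (ler_wpM2l (p0 x) (le_Z x)); lra.
Qed.

Lemma variance_compl (S : T -> R) (r : R) : V (fun x => r - S x) = V S.
Proof.
have -> : E (fun x => r - S x) = r - E S.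
  rewrite -[r in RHS]mulr1 -p1 mulr_sumr -sumrB.
  by apply: eq_bigr => x _; ring.
by apply: eq_bigr => x _; ring.
Qed.

(** Three regimes: a small mean [m], where folding needs a deviation of order [n]; a larger mean
    with [rho <= n / 3], where [S1] suffices; and [rho > n / 3], where [S2] is called upon. *)
Lemma folded_loss_ge (n c alpha rho : R) (Z S1 S2 : T -> R) :
  0 < n -> 1 <= c -> 0 < alpha <= 1 -> 9 * c ^+ 10 <= alpha ^+ 2 * n ->
  0 <= rho -> 2 * rho <= n ->
  rho <= E S1 <= n - rho -> rho <= E S2 <= n - rho ->
  V S1 <= c ^+ 4 * rho -> V S2 <= c ^+ 4 * rho ->
  (forall x, [\/ S1 x <= Z x, n - S1 x <= Z x | n / 3 <= Z x]) ->
  (forall x, [\/ S1 x <= Z x \/ n - S1 x <= Z x, S2 x <= Z x \/ n - S2 x <= Z x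
     | n / 2 <= Z x]) ->
  (1 - alpha) * rho <= E Z.
Proof.
move=> n0 c1 /andP[a0 a1] cn r0 rn.
(* Exchanging [S1] with [n - S1] preserves the hypotheses and reflects the mean about [n / 2]. *)
wlog mu1 : S1 / 2 * E S1 <= n.
  move=> wl m1 m2 V1 V2 Z1 Z2.
  have [?|lt_m] := lerP (2 * E S1) n; first exact: (wl S1).
  have ES : E (fun x => n - S1 x) = n - E S1.
    rewrite -[n in RHS]mulr1 -p1 mulr_sumr -sumrB.
    by apply: eq_bigr => x _; ring.
  apply: (wl (fun x => n - S1 x)); rewrite ?variance_compl ?ES //; try lra.
  - by move=> x; have [] := Z1 x => ?; [apply: Or32|apply: Or31|apply: Or33]; lra.
  - move=> x; have [[?|?]|[?|?]|?] := Z2 x.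
    + by apply: Or31; right; lra.
    + by apply: Or31; left; lra.
    + by apply: Or32; left; lra.
    + by apply: Or32; right; lra.
    + by apply: Or33; lra.
set m := E S1 in mu1 *; set m2 := E S2 => /andP[rm _] /andP[rm2 m2r].
set V1 := V S1; set V2 := V S2 => V1le V2le Z1 Z2.
have c4 : 1 <= c ^+ 4 by rewrite exprn_ege1.
have c46 : c ^+ 4 <= c ^+ 10 by rewrite ler_weXn2l.
have V20 : 0 <= V2 by apply: sumr_ge0 => x _; rewrite mulr_ge0 ?sqr_ge0.
have a2 : alpha ^+ 2 <= alpha by rewrite expr2 ler_piMl // ltW.
have r1a : (1 - alpha) * rho <= rho by rewrite ler_piMl //; lra.
have anV : 9 * c ^+ 4 <= alpha ^+ 2 * n by lra.
(* AM-GM, used with [t] equal to [alpha] times the target mean, which dominates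
   the standard deviations. *)
have amgm (t d : R) : 0 < t -> `|d| <= t / 2 + (2 * t)^-1 * d ^+ 2.
  move=> t0; rewrite -subr_ge0 -(real_normK (num_real d)).
  rewrite (_ : _ - _ = (2 * t)^-1 * (t - `|d|) ^+ 2).
    by rewrite mulr_ge0 ?sqr_ge0 // invr_ge0 mulr_ge0 // ltW.
  by field; rewrite gt_eqF.
have t2 (t v : R) : 0 < t -> v <= t ^+ 2 -> t / 2 + (2 * t)^-1 * v <= t.
  move=> t0 vt; have : (2 * t)^-1 * v <= (2 * t)^-1 * t ^+ 2.
    by rewrite ler_wpM2l // invr_ge0 mulr_ge0 // ltW.
  rewrite [X in _ <= X](_ : _ = t / 2); first lra.
  by field; rewrite gt_eqF.
(* Since [m <= n / 4], the alternatives [n - S1] and [n / 3] fall below [S1] only if [S1 - m]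
   exceeds a fixed fraction of [n]; the penalty [6 / n] times its square then pays for the
   difference. *)
have [m4|m4] := lerP (4 * m) n.
  apply: le_trans (_ : 0 + 1 * m - (6 / n) * V1 - 0 * V2 <= _); last first.
    apply: expectation_quadratic_le => x; rewrite -/m -/m2 mul0r subr0 add0r mul1r.
    set d := S1 x - m; have dE : S1 x = m + d by rewrite /d; ring.
    have nd : 0 <= 6 / n * d ^+ 2 by rewrite mulr_ge0 ?sqr_ge0 // divr_ge0 // ltW.
    have nq : 6 / n * d ^+ 2 * n = 6 * d ^+ 2 by field; rewrite gt_eqF.
    set w := 6 / n * d ^+ 2 in nd nq *.
    have [?|?|?] := Z1 x; first by lra.
    + suff : 2 * S1 x - n <= w by lra.
      rewrite -(ler_pM2r n0) nq dE.
      have : 0 <= (2 * d - n / 2) ^+ 2 by exact: sqr_ge0.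
      have : 0 <= n * (n - 4 * m) by rewrite mulr_ge0 ?subr_ge0 // ltW.
      nra.
    + suff : S1 x - n / 3 <= w by lra.
      rewrite -(ler_pM2r n0) nq dE.
      have : 0 <= (d - n / 12) ^+ 2 by exact: sqr_ge0.
      have : 0 <= n * (n - 4 * m) by rewrite mulr_ge0 ?subr_ge0 // ltW.
      nra.
  have : 6 / n * V1 <= alpha * rho.
    rewrite mulrAC ler_pdivrMr //.
    apply: le_trans (_ : 6 * (c ^+ 4 * rho) <= _); first by rewrite ler_pM2l.
    have -> : 6 * (c ^+ 4 * rho) = rho * (6 * c ^+ 4) by ring.
    have -> : alpha * rho * n = rho * (alpha * n) by ring.
    rewrite ler_wpM2l //.
    have : alpha ^+ 2 * n <= alpha * n by rewrite ler_wpM2r // ltW.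
    lra.
  lra.
have [r3|r3] := lerP (3 * rho) n.
  (* [Z >= mm - |S1 - m|] in all three cases, because [2 * m <= n]; and [n < 4 * mm] makes the
     standard deviation of [S1] at most [alpha * mm]. *)
  pose mm := Num.min m (n / 3).
  have mm_m : mm <= m by rewrite ge_min lexx.
  have mm_n : mm <= n / 3 by rewrite ge_min lexx orbT.
  have rmm : rho <= mm by rewrite le_min rm /=; lra.
  have nmm : n < 4 * mm.
    by rewrite /mm; case: (leP m (n / 3)) => _; lra.
  pose t := alpha * mm.
  have t0 : 0 < t by rewrite mulr_gt0 //; lra.
  apply: le_trans (_ : (mm - t / 2) + 0 * m - (2 * t)^-1 * V1 - 0 * V2 <= _); last first.
    apply: expectation_quadratic_le => x; rewrite -/m -/m2 !mul0r subr0 addr0.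
    have := amgm _ (S1 x - m) t0; have := ler_norm (S1 x - m).
    have := ler_norm (- (S1 x - m)); rewrite normrN.
    have := normr_ge0 (S1 x - m).
    set w := (2 * t)^-1 * _; set N := `|_|.
    by have [?|?|?] := Z1 x; lra.
  have V1t : V1 <= t ^+ 2.
    rewrite exprMn; apply: (le_trans V1le).
    apply: le_trans (_ : c ^+ 4 * mm <= _); first by rewrite ler_wpM2l //; lra.
    rewrite [mm ^+ 2]expr2 mulrA ler_wpM2r //; first lra.
    have : alpha ^+ 2 * n <= alpha ^+ 2 * (4 * mm) by rewrite ler_wpM2l ?sqr_ge0 // ltW.
    lra.
  have := t2 _ _ t0 V1t.
  have : (1 - alpha) * rho <= (1 - alpha) * mm by rewrite ler_wpM2l // subr_ge0.
  rewrite /t; lra.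
(* Now the cap [n / 3] is below [rho], whereas [n / 2] is not. The means of [S1] and [S2] stay at
   distance at least [rho] from 0 and [n], so [Z] falls below [rho] only through a deviation of one
   of them. *)
pose t := alpha * rho.
have t0 : 0 < t by rewrite mulr_gt0 //; lra.
apply: le_trans (_ : (rho - t / 2) + 0 * m - (2 * t)^-1 * V1 - (2 * t)^-1 * V2 <= _); last first.
  apply: expectation_quadratic_le => x; rewrite -/m -/m2 !mul0r addr0.
  have k0 : 0 <= (2 * t)^-1 by rewrite invr_ge0 mulr_ge0 // ltW.
  have := amgm _ (S1 x - m) t0; have := ler_norm (S1 x - m).
  have := ler_norm (- (S1 x - m)); rewrite normrN.
  have := amgm _ (S2 x - m2) t0; have := ler_norm (S2 x - m2).
  have := ler_norm (- (S2 x - m2)); rewrite normrN.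
  have := mulr_ge0 k0 (sqr_ge0 (S1 x - m)); have := mulr_ge0 k0 (sqr_ge0 (S2 x - m2)).
  set w := (2 * t)^-1 * _; set w' := (2 * t)^-1 * _; set N := `|_|; set N' := `|_|.
  by have [[?|?]|[?|?]|?] := Z2 x; lra.
have V12t : V1 + V2 <= t ^+ 2.
  apply: le_trans (_ : 2 * c ^+ 4 * rho <= _); first lra.
  have -> : t ^+ 2 = alpha ^+ 2 * rho * rho by rewrite /t; ring.
  rewrite ler_wpM2r //.
  have : alpha ^+ 2 * n <= alpha ^+ 2 * (3 * rho) by rewrite ler_wpM2l ?sqr_ge0 // ltW.
  lra.
have := t2 _ _ t0 V12t.
rewrite /t; lra.
Qed.

End FoldedLoss.

(** * Posterior loss of a partition along a two-state path *)

Section PosteriorLoss.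
Context (R : realType) (n : nat).

(** The maximum is attained, since the empty matching is always admissible. *)
Lemma lossE (A B : {set {set 'I_n}}) : (0 < n)%N ->
  exists2 M, is_matching A B M &
    n%:R * loss R A B = n%:R - (\sum_(e in M) #|e.1 :&: e.2|%SET)%N%:R.
Proof.
move=> n0; have m0 : is_matching A B finset.set0.
  by rewrite /is_matching finset.sub0set; apply/forall_inP => e; rewrite finset.inE.
have [|M MAB maxE] := @eq_bigmax_cond _ (fun M => is_matching A B M)
    (fun M => \sum_(e in M) #|e.1 :&: e.2|%SET)%N.
  by apply/card_gt0P; exists finset.set0.
exists M => //; rewrite /loss maxE mulrBr mulr1 mulrA divff ?mul1r //.
by rewrite pnatr_eq0 -lt0n.
Qed.

Lemma mul_le_min (x y : R) : x + y = 1 -> 0 <= x -> 0 <= y ->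
  x * y <= Num.min x y.
Proof. by move=> xy x0 y0; rewrite le_min; apply/andP; split; nra. Qed.

Definition label_error (ks : nat -> 'I_2 -> 'I_2 -> R) a (i : 'I_n) (b : 'I_2) : R :=
  path_sum n ks (fun s => (nth ord0 s i != b)%:R) a.

(** Instance of [folded_loss_ge] under the law of the path: [Z] is [n] times the loss, and [S1],
    [S2] count the errors of the labellings separating [D1], [D2] from the rest. *)
Lemma stochastic_path_loss_ge (qs : nat -> 'I_2 -> 'I_2 -> R) (c alpha : R) a
    (A : {set {set 'I_n}}) :
  (0 < n)%N -> 1 <= c -> 0 < alpha <= 1 -> 9 * c ^+ 10 <= alpha ^+ 2 * n%:R ->
  (forall i, stochastic (qs i)) -> (forall i, mixing (c ^+ 2) (qs i)) ->
  finset.partition A [set: 'I_n]%SET ->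
  (1 - alpha) * (n%:R^-1 *
    \sum_(i < n) Num.min (label_error qs a i ord0) (label_error qs a i ord_max)) <=
  path_sum n qs (fun s => loss R A (level_partition (fun i : 'I_n => nth ord0 s i))) a.
Proof.
move=> n0 c1 a01 cn qst qmix pA; set err := label_error qs a.
have nR : 0 < n%:R :> R by rewrite ltr0n.
have c21 : 1 <= c ^+ 2 by rewrite exprn_ege1.
have [D1 [D2 two]] := matching_two_blocks pA.
set rho := \sum_(i < n) _.
have err0 i b : 0 <= err i b.
  by apply: path_sum_ge0 => [k x y|s]; [have [] := qmix k x x y|rewrite ler0n].
have err1 i : err i ord0 + err i ord_max = 1.
  rewrite -path_sumD -[RHS](path_sum_cst n 1 a qst); apply: eq_path_sum => s _.
  by move: (nth _ _ _); apply: ord2_ind; rewrite /= ?addr0 ?add0r.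
(* Extends the labelling to [nat], with an irrelevant value out of range. *)
pose hD (D : {set 'I_n}) (i : nat) := if insub i is Some j then side_label D j else ord0.
have hDE D (i : 'I_n) : hD D i = side_label D i by rewrite /hD valK.
pose w (t : n.-tuple 'I_2) := \prod_(i < n) qs i (nth a (a :: t) i) (nth a t i).
have wE F : path_sum n qs F a = \sum_t w t * F t by exact: path_sumE.
pose x (t : n.-tuple 'I_2) (i : 'I_n) := nth ord0 t i.
pose S D (t : n.-tuple 'I_2) : R := (side_errors D (x t))%:R.
have SE D t : S D t = mismatches R n (hD D) t.
  by rewrite /S /side_errors natr_sum; apply: eq_bigr => i _; rewrite hDE.
have ES D : \sum_t w t * S D t = \sum_(i < n) err i (side_label D i).
  under eq_bigr => t _ do rewrite SE.
  rewrite -wE path_sum_mismatches; apply: eq_bigr => i _.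
  by rewrite /mismatch_prob hDE.
(* The two error probabilities sum to 1: each lies between the minimum and its complement, and their
   product is below the minimum. *)
have minE i b : Num.min (err i ord0) (err i ord_max) <= err i b /\
    err i b * (1 - err i b) <= Num.min (err i ord0) (err i ord_max) /\
    err i b <= 1 - Num.min (err i ord0) (err i ord_max).
  have e1 := err1 i; have := mul_le_min e1 (err0 i ord0) (err0 i ord_max).
  move: b; apply: ord2_ind.
    have -> : 1 - err i ord0 = err i ord_max by rewrite -e1 addrC addKr.
    by have [le01|le01] := leP (err i ord0) (err i ord_max) => ?; do ?split=> //; lra.
  have -> : 1 - err i ord_max = err i ord0 by rewrite -e1 addrK.
  by rewrite mulrC; have [le01|le01] := leP (err i ord0) (err i ord_max) => ?; do ?split=> //; lra.
have ES_rho D : rho <= \sum_t w t * S D t <= n%:R - rho.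
  rewrite ES; apply/andP; split; first by apply: ler_sum => i _; have [] := minE i (side_label D i).
  rewrite -[n in n%:R]card_ord -sumr_const -sumrB; apply: ler_sum => i _.
  by have [_ []] := minE i (side_label D i).
have VS D : \sum_t w t * (S D t - \sum_t w t * S D t) ^+ 2 <= c ^+ 4 * rho.
  have mE : \sum_t w t * S D t = path_sum n qs (mismatches R n (hD D)) a.
    by rewrite wE; apply: eq_bigr => t _; rewrite SE.
  rewrite mE; under eq_bigr => t _ do rewrite SE.
  rewrite -(wE (fun s => (mismatches R n (hD D) s - _) ^+ 2)).
  apply: le_trans (variance_mismatches_le n (hD D) a c21 qst qmix) _.
  rewrite -exprM ler_wpM2l ?exprn_ge0 ?(le_trans ler01) //; apply: ler_sum => i _.
  by rewrite /mismatch_prob hDE; have [_ []] := minE i (side_label D i).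
have rho0 : 0 <= rho by apply: sumr_ge0 => i _; rewrite le_min !err0.
have rho2 : 2 * rho <= n%:R.
  by have := ES_rho D1; move=> /andP[]; lra.
pose Z (t : n.-tuple 'I_2) := n%:R * loss R A (level_partition (x t)).
have ZE t : exists s : nat, [/\ Z t = n%:R - s%:R,
    ((s + side_errors D1 (x t) <= n)%N || (s <= side_errors D1 (x t))%N) \/ (3 * s <= 2 * n)%N &
    [\/ (s + side_errors D1 (x t) <= n)%N || (s <= side_errors D1 (x t))%N,
       (s + side_errors D2 (x t) <= n)%N || (s <= side_errors D2 (x t))%N | (2 * s <= n)%N]].
  have [M MA ME] := lossE A (level_partition (x t)) n0.
  by have [two1 two2] := two _ _ MA; eexists; split; [exact: ME|exact: two1|exact: two2].
have near D t s : Z t = n%:R - s%:R ->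
    (s + side_errors D (x t) <= n)%N || (s <= side_errors D (x t))%N ->
    S D t <= Z t \/ n%:R - S D t <= Z t.
  move=> -> /orP[]; rewrite -(ler_nat R) ?natrD => h; [left|right]; rewrite /S; lra.
suff : (1 - alpha) * rho <= \sum_t w t * Z t.
  move=> le_rho; rewrite wE mulrCA -(ler_pM2l nR) mulVKf ?gt_eqF //.
  rewrite [X in _ <= X]mulr_sumr.
  by under eq_bigr => t _ do rewrite mulrCA.
apply: (@folded_loss_ge R _ w _ _ n%:R c alpha rho Z (S D1) (S D2)) => //.
- by move=> t; apply: prodr_ge0 => i _;
  have [] := qmix i (nth a (a :: t) i) (nth a (a :: t) i) (nth a t i).
- by rewrite -[RHS](path_sum_cst n 1 a qst) wE; apply: eq_bigr => t _; rewrite mulr1.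
- move=> t; have [s [Zs [n1|s3] _]] := ZE t.
    by have [?|?] := near _ _ _ Zs n1; [apply: Or31|apply: Or32].
  apply: Or33; move: s3; rewrite -(ler_nat R) !natrM Zs; lra.
- move=> t; have [s [Zs _ [n1|n2|s2]]] := ZE t.
  + by apply: Or31; exact: near Zs n1.
  + by apply: Or32; exact: near Zs n2.
  apply: Or33; move: s2; rewrite -(ler_nat R) !natrM Zs; lra.
Qed.

(** Normalisation takes the same nonnegative mass out of both sides; a zero mass, that is an
    observation of zero likelihood, is thereby included. *)
Lemma path_loss_ge (ks : nat -> 'I_2 -> 'I_2 -> R) (c alpha : R) a
    (A : {set {set 'I_n}}) :
  (0 < n)%N -> 1 <= c -> 0 < alpha <= 1 -> 9 * c ^+ 10 <= alpha ^+ 2 * n%:R ->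
  (forall i, mixing c (ks i)) ->
  finset.partition A [set: 'I_n]%SET ->
  (1 - alpha) * (n%:R^-1 *
    \sum_(i < n) Num.min (label_error ks a i ord0) (label_error ks a i ord_max)) <=
  path_sum n ks (fun s => loss R A (level_partition (fun i : 'I_n => nth ord0 s i))) a.
Proof.
move=> n0 c1 a01 cn kmix pA.
have [qs [qst qmix kE]] := path_sum_normalize n c1 kmix.
have W0 : 0 <= path_sum n ks (fun=> 1) a.
  by apply: path_sum_ge0 => // i x y; have [] := kmix i x x y.
rewrite kE; have := stochastic_path_loss_ge a n0 c1 a01 cn qst qmix pA.
move=> /(ler_wpM2l W0); apply: le_trans; rewrite [X in _ <= X]mulrCA.
rewrite ler_wpM2l ?subr_ge0 //; first by case/andP: a01.
rewrite [X in _ <= X]mulrCA ler_wpM2l ?invr_ge0 // mulr_sumr ler_sum // => i _.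
have errE b : label_error ks a i b = path_sum n ks (fun=> 1) a * label_error qs a i b.
  exact: kE.
by rewrite !errE minr_pMr.
Qed.

End PosteriorLoss.

(** * The constant *)

Section AlphaBound.
Context (R : realType).

(** Obtained from [1 + x <= expR x] at 1/16, raised to the power 16. *)
Lemma expR1_ge : 263 / 100 <= expR 1 :> R.
Proof.
have -> : expR 1 = expR (16^-1 : R) ^+ 16.
  by rewrite -expRM_natl -mulr_natl mulfV // pnatr_eq0.
apply: le_trans (_ : (1 + 16^-1) ^+ 16 <= _); first by lra.
by apply: lerXn2r; rewrite ?nnegrE ?expR_ge0 ?expR_ge1Dx //; lra.
Qed.

(** Amounts to [expR 2 <= 2 ^+ 3], from [expR (- 16^-1) >= 15 / 16] raised to the power 32. *)
Lemma ln2_ge : 2 / 3 <= ln 2 :> R.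
Proof.
have e8 : expR 2 <= 2 ^+ 3 :> R.
  have -> : expR 2 = expR (16^-1 : R) ^+ 32 by rewrite -expRM_natl; congr expR; field.
  have e16 : expR 16^-1 <= 16 / 15 :> R.
    have := expR_ge1Dx (- 16^-1 : R); rewrite expRN => eN.
    have e0 : 0 < expR (16^-1 : R) := expR_gt0 _.
    have : expR 16^-1 * (15 / 16) <= expR 16^-1 * (expR 16^-1)^-1 :> R.
      by rewrite ler_pM2l //; lra.
    by rewrite mulfV ?gt_eqF //; lra.
  apply: le_trans (_ : (16 / 15) ^+ 32 <= _); last by lra.
  by apply: lerXn2r e16; rewrite nnegrE ?expR_ge0 //; lra.
have : 2 <= ln (2 ^+ 3) :> R.
  by rewrite -[leLHS]expRK ler_ln // posrE ?expR_gt0.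
by rewrite lnXn // -mulr_natl; lra.
Qed.

Lemma e2ln2_ge : 9 / 2 <= expR 1 ^+ 2 * ln 2 :> R.
Proof.
apply: le_trans (_ : (263 / 100) ^+ 2 * (2 / 3) <= _); first by lra.
apply: ler_pM; [by lra|by lra|apply: lerXn2r expR1_ge|exact: ln2_ge].
  by rewrite nnegrE; lra.
by rewrite nnegrE expR_ge0.
Qed.

Lemma ln2_le : ln 2 <= 1 :> R.
Proof. by have := @le_ln1Dx R 1; rewrite -natr1; apply. Qed.

(** If the value is at most 1, so is the base [x]; raising [x] to an exponent at most 1 then does
    not decrease it. The square of [2 * e * c ^+ 4 * x] times [n] is exactly [c ^+ 10] times 2 e^2
    log 2. *)
Lemma alpha_tilde_bound (delta : R) n : 0 < delta -> 2 * delta <= 1 -> (0 < n)%N ->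
  alpha_tilde delta n <= 1 ->
  0 < alpha_tilde delta n /\
  9 * ((1 - delta) / delta) ^+ 10 <= alpha_tilde delta n ^+ 2 * n%:R.
Proof.
move=> d0 d2 n0; rewrite /alpha_tilde.
set c := (1 - delta) / delta; set x := c * _; set e := expR 1.
have c1 : 1 <= c by rewrite ler_pdivlMr //; lra.
have nR : 1 <= n%:R :> R by rewrite ler1n.
have l2 := ln2_ge; have l1 := ln2_le; have e2 : 263 / 100 <= e := expR1_ge.
have s0 : 0 < ln 2 / (2 * n%:R) :> R by rewrite divr_gt0 ?mulr_gt0 //; lra.
have s1 : Num.sqrt (ln 2 / (2 * n%:R)) <= 1 :> R.
  by rewrite -[leRHS]sqrtr1 ler_wsqrtr // ler_pdivrMr; lra.
have x0 : 0 < x by rewrite mulr_gt0 ?sqrtr_gt0 //; lra.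
have c4 : 1 <= c ^+ 4 by rewrite exprn_ege1.
have c3 : 1 <= c ^+ 3 by rewrite exprn_ege1.
set y := x `^ _ => a1.
have y0 : 0 < y by rewrite powR_gt0.
have c40 : 0 < c ^+ 4 by exact: lt_le_trans c4.
have e0 : 0 < 2 * e by lra.
have ec0 : 0 < 2 * e * c ^+ 4 by rewrite mulr_gt0.
have a0 : 0 < 2 * e * c ^+ 4 * y by rewrite mulr_gt0.
split=> //.
have xy : x <= y.
  have [x1|x1] := lerP x 1.
    by rewrite -[leLHS](powRr1 (ltW x0)) /y ger_powR ?x0 // lerBlDr lerDl divr_ge0.
  (* For [x > 1] the value would exceed 1: the exponent is nonnegative for [n >= 2]; for [n = 1] it
     is -1, and [x <= c] leaves at least [2 * e * c ^+ 3]. *)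
  exfalso; move: a1; apply/negP; rewrite -ltNge.
  have [n1|n1] := leqP n 1.
    have nE : n = 1%N by apply/eqP; rewrite eqn_leq n1.
    have yE : y = x^-1.
      rewrite /y nE divr1 (_ : 1 - 2 = -1); last by lra.
      by rewrite powR_inv1 // ltW.
    have xc : x <= c by rewrite -[leRHS]mulr1 ler_wpM2l //; lra.
    have : 2 * e * c ^+ 3 <= 2 * e * c ^+ 4 * y.
      rewrite yE ler_pdivlMr // (_ : 2 * e * c ^+ 4 = 2 * e * c ^+ 3 * c); last by ring.
      by rewrite ler_wpM2l // mulr_ge0 //; lra.
    have : 2 * e * 1 <= 2 * e * c ^+ 3 by rewrite ler_wpM2l //; lra.
    lra.
  have y1 : 1 <= y.
    rewrite -(powRr0 x) /y ler_powR ?(ltW x1) // subr_ge0 ler_pdivrMr; last lra.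
    by rewrite mul1r ler_nat.
  have : 1 * 1 <= c ^+ 4 * y by rewrite ler_pM.
  have : 2 * e * (c ^+ 4 * y) = 2 * e * c ^+ 4 * y by rewrite mulrA.
  nra.
apply: le_trans (_ : (2 * e * c ^+ 4 * x) ^+ 2 * n%:R <= _); last first.
  rewrite ler_wpM2r // lerXn2r ?nnegrE ?(ltW a0) //.
    by rewrite mulr_ge0 // ltW.
  by rewrite ler_wpM2l // ltW.
have -> : (2 * e * c ^+ 4 * x) ^+ 2 * n%:R = c ^+ 10 * (2 * (e ^+ 2 * ln 2)).
  rewrite /x !exprMn sqr_sqrtr ?(ltW s0) //; field.
  by rewrite gt_eqF //; lra.
rewrite [9 * _]mulrC ler_wpM2l //; first by rewrite exprn_ge0 // (le_trans ler01).
by have := e2ln2_ge; rewrite -/e; lra.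
Qed.

End AlphaBound.

(** * Level partitions *)

Section LevelPartition.
Context (n J : nat).
Implicit Types x h : 'I_n -> 'I_J.

Lemma mem_level_partition x (C : {set 'I_n}) : C \in level_partition x ->
  exists2 a, C = [set i | x i == a]%SET & C != finset.set0.
Proof. by case/setD1P => C0 /imsetP[a _ CE]; exists a. Qed.

Lemma level_partitionP x : finset.partition (level_partition x) [set: 'I_n]%SET.
Proof.
apply/and3P; split.
- rewrite finset.eqEsubset finset.subsetT; apply/fintype.subsetP => i _.
  apply/finset.bigcupP; exists [set j | x j == x i]%SET; last by rewrite finset.inE.
  rewrite !finset.inE imset_f // andbT; apply/finset.set0Pn; exists i.
  by rewrite finset.inE.
- apply/finset.trivIsetP => C D /mem_level_partition[a -> _] /mem_level_partition[b -> _] ab.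
  rewrite finset.disjoints_subset; apply/fintype.subsetP => i; rewrite !finset.inE => /eqP ->.
  by apply: contraNneq ab => ->.
- by rewrite !finset.inE eqxx.
Qed.

(** Blocks carrying the same label are matched whenever both are nonempty; this covers exactly the
    indices where [h] and [x] agree. *)
Lemma loss_level_le (R : realType) h x : (0 < n)%N ->
  loss R (level_partition h) (level_partition x) <=
  n%:R^-1 * \sum_(i < n) (h i != x i)%:R.
Proof.
move=> n0; have nR : 0 < n%:R :> R by rewrite ltr0n.
pose B (y : 'I_n -> 'I_J) (a : 'I_J) : {set 'I_n} := [set i | y i == a]%SET.
pose S := [set a | (B h a != finset.set0) && (B x a != finset.set0)]%SET.
have Binj y a b : B y a != finset.set0 -> B y a = B y b -> a = b.
  move=> /finset.set0Pn[i iB] Bab; have := iB; rewrite Bab finset.inE => /eqP <-.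
  by move: iB; rewrite finset.inE => /eqP ->.
pose M := [set (B h a, B x a) | a in S]%SET.
have MM : is_matching (level_partition h) (level_partition x) M.
  apply/andP; split.
    apply/fintype.subsetP => _ /imsetP[a + ->]; rewrite !finset.inE => /andP[ha xa] /=.
    by rewrite ha xa !imset_f.
  apply/forall_inP => _ /imsetP[a + ->]; rewrite finset.inE => /andP[ha xa].
  apply/forall_inP => _ /imsetP[b + ->]; rewrite finset.inE => /andP[hb xb].
  apply/implyP => ne; apply/andP; split; apply: contra ne => /eqP /= eqB.
    by rewrite (Binj _ _ _ ha eqB).
  by rewrite (Binj _ _ _ xa eqB).
have MS : (\sum_(e in M) #|e.1 :&: e.2|%SET = \sum_(i < n) (h i == x i))%N.
  rewrite big_imset /=; last first.
    by move=> a b; rewrite !finset.inE => /andP[ha _] _ [/Binj -> //].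
  transitivity (\sum_(a : 'I_J) #|B h a :&: B x a|%SET)%N.
    rewrite big_mkcond; apply: eq_bigr => a _; rewrite finset.inE.
    have [->|_] := eqVneq (B h a); first by rewrite finset.set0I cards0.
    by have [->|_] := eqVneq (B x a); first by rewrite finset.setI0 cards0.
  transitivity (\sum_(a : 'I_J) \sum_(i < n) ((h i == a) && (x i == a)))%N.
    apply: eq_bigr => a _; rewrite -sum1_card big_mkcond; apply: eq_bigr => i _.
    by rewrite !finset.inE; case: (_ && _).
  rewrite exchange_big; apply: eq_bigr => i _ /=.
  rewrite (bigD1 (h i)) //= eqxx eq_sym big1 ?addn0 // => a /negPf ha.
  by rewrite eq_sym ha.
rewrite /loss -(ler_pM2l nR) mulVKf ?gt_eqF // mulrBr mulr1 mulVKf ?gt_eqF //.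
have -> : \sum_(i < n) (h i != x i)%:R = n%:R - (\sum_(i < n) (h i == x i))%N%:R :> R.
  rewrite -[n in n%:R]card_ord -sum1_card !natr_sum -sumrB; apply: eq_bigr => i _.
  by case: (h i == x i); rewrite /= ?subrr ?subr0.
rewrite lerD2l lerN2 ler_nat -MS.
exact: (bigop.bigmax_sup M).
Qed.

End LevelPartition.

Lemma loss_ge0 (R : realType) n (A : {set {set 'I_n}}) (x : 'I_n -> 'I_2) : (0 < n)%N ->
  finset.partition A [set: 'I_n]%SET -> 0 <= loss R A (level_partition x).
Proof.
move=> n0 pA; have [M MM ME] := lossE R A (level_partition x) n0.
rewrite -(@pmulr_rge0 _ n%:R) ?ltr0n // ME subr_ge0 ler_nat.
have [C0 [C1 [_ _ _ le_M]]] := matching_level_le pA MM.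
by apply: leq_trans le_M _; rewrite -[X in (_ <= X)%N]card_ord max_card.
Qed.

Local Open Scope classical_set_scope.

(** * Densities on product spaces *)

Section ImageDensity.
Context d d' (T : measurableType d) (T' : measurableType d') (R : realType)
  (mu : {measure set T -> \bar R}) (p : T -> T') (f : T -> \bar R).

(* The proofs are arguments so that the measure structure can be inferred. *)
Definition image_density of measurable_fun [set: T] p & measurable_fun [set: T] f &
    (forall x, (0 <= f x)%E) : set T' -> \bar R :=
  fun A => (\int[mu]_(x in p @^-1` A) f x)%E.

Hypotheses (mp : measurable_fun [set: T] p) (mf : measurable_fun [set: T] f)
  (f0 : forall x, (0 <= f x)%E).

Local Notation nu := (image_density mp mf f0).

Let image_density0 : nu set0 = 0%E.
Proof. by rewrite /image_density preimage_set0 integral_set0. Qed.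

Let image_density_ge0 A : (0 <= nu A)%E.
Proof. exact: integral_ge0. Qed.

Let image_density_sigma_additive : semi_sigma_additive nu.
Proof.
move=> F mF tF mUF; rewrite /image_density preimage_bigcup ge0_integral_bigcup //.
- by apply: is_cvg_ereal_nneg_natsum_cond => n _ _; exact: integral_ge0.
- by move=> k; rewrite -[X in measurable X]setTI; exact: mp.
- exact: measurable_funTS.
- apply/trivIsetP => i j _ _ ij; rewrite -preimage_setI.
  by move/trivIsetP : tF => ->; rewrite // preimage_set0.
Qed.

HB.instance Definition _ := isMeasure.Build _ _ _ nu
  image_density0 image_density_ge0 image_density_sigma_additive.

End ImageDensity.

(* In the library, the sigma-finite instance of [m1 \x m2] is masked by the one
   for subprobabilities, hence this alias. *)
Section SigmaFiniteProduct.
Context d1 d2 (T1 : measurableType d1) (T2 : measurableType d2) (R : realType).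
Variables (m1 : {sigma_finite_measure set T1 -> \bar R})
  (m2 : {sigma_finite_measure set T2 -> \bar R}).

Definition sigma_finite_product : set (T1 * T2) -> \bar R := (m1 \x m2)%E.

HB.instance Definition _ := Measure.on sigma_finite_product.

Let sigma_finite_productT : sigma_finite setT sigma_finite_product.
Proof.
have /sigma_finiteP[F [FT ndF Foo]] := sigma_finiteT m1.
have /sigma_finiteP[G [GT ndG Goo]] := sigma_finiteT m2.
exists (fun k => F k `*` G k) => [|k].
  apply/seteqP; split=> // -[x y] _.
  have [i _ Fx] : (\bigcup_k F k) x by rewrite -FT.
  have [j _ Gy] : (\bigcup_k G k) y by rewrite -GT.
  exists (maxn i j) => //; split.
  - by move: Fx; exact/subsetPset/ndF/leq_maxl.
  - by move: Gy; exact/subsetPset/ndG/leq_maxr.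
have [mF Fk] := Foo k; have [mG Gk] := Goo k; split; first exact: measurableX.
rewrite /sigma_finite_product product_measure1E //.
by rewrite lte_mul_pinfty // ge0_fin_numE.
Qed.

HB.instance Definition _ := Measure_isSigmaFinite.Build _ _ _
  sigma_finite_product sigma_finite_productT.

End SigmaFiniteProduct.

Section TupleMeasure.
Context d (T : measurableType d) (R : realType).

Definition rectangle n (A : nat -> set T) : set (n.-tuple T) :=
  [set t | forall i : 'I_n, A i (tnth t i)].

Lemma measurable_rectangle n (A : nat -> set T) : (forall i, measurable (A i)) ->
  measurable (rectangle (n := n) A).
Proof.
move=> mA; rewrite (_ : rectangle A = \bigcap_(i in [set: 'I_n]) ((@tnth n T)^~ i @^-1` A i)).
  apply: fin_bigcap_measurable => // i _.
  by rewrite -[X in measurable X]setTI; exact: (measurable_tnth i measurableT).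
by apply/seteqP; split=> t /= tA i; [move=> _|]; exact: tA.
Qed.

(** Presents the product sigma-algebra by a pi-system: a one-coordinate cylinder is a rectangle
    whose other sides are full. *)
Lemma measurable_tuple_rectangles n : @measurable _ (n.-tuple T) =
  <<s [set rectangle A | A in [set A : nat -> set T | forall i, measurable (A i)]] >>.
Proof.
apply/seteqP; split; last first.
  apply: smallest_sub; first exact: sigma_algebra_measurable.
  by move=> _ [A mA <-]; exact: measurable_rectangle.
apply: smallest_sub; first exact: smallest_sigma_algebra.
rewrite -bigcup_seq => _ [i _ [B mB <-]]; apply: sub_sigma_algebra.
exists (fun j => if j == i :> nat then B else setT); first by move=> j; case: eqP.
rewrite setTI; apply/seteqP; split=> t /= tB; first by have := tB i; rewrite eqxx.
by move=> j; case: eqP => [/val_inj ->|].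
Qed.

Lemma tuple_measure_unique n (m1 m2 : {measure set (n.-tuple T) -> \bar R}) :
  (forall A : nat -> set T, (forall i, measurable (A i)) ->
    m1 (rectangle A) = m2 (rectangle A)) ->
  (m1 setT < +oo)%E -> forall A, measurable A -> m1 A = m2 A.
Proof.
move=> m12 m1oo A mA.
have rT : rectangle (n := n) (fun=> [set: T]) = setT by apply/seteqP; split.
apply: (@measure_unique _ _ _ _ (fun=> setT) (measurable_tuple_rectangles n)) => //.
- move=> _ _ [B mB <-] [C mC <-]; exists (fun i => B i `&` C i).
    by move=> i; exact: measurableI.
  apply/seteqP; split=> t /=; first by move=> BC; split=> i; have [] := BC i.
  by move=> [tB tC] i; split.
- by move=> i; exists (fun=> setT).
- by rewrite bigcup_const.
- by move=> _ [B mB <-]; exact: m12.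
Qed.

(* The n-fold product of [L], realised on nested pairs rather than on tuples,
   whence the abstract space [U] and its coordinate map [p]. *)
Lemma product_measure_exists n (L : {sigma_finite_measure set T -> \bar R}) :
  exists d' (U : measurableType d') (M : {sigma_finite_measure set U -> \bar R})
    (p : U -> n.-tuple T), measurable_fun [set: U] p /\
  forall f : nat -> T -> R, (forall i, measurable_fun [set: T] (f i)) ->
    (forall i y, 0 <= f i y) ->
    (\int[M]_u (\prod_(i < n) f i (tnth (p u) i))%:E
     = \prod_(i < n) \int[L]_y (f i y)%:E)%E.
Proof.
elim: n => [|n [d' [U [M [p [mp pE]]]]]].
  exists _, unit, (\d_tt : {sigma_finite_measure set unit -> \bar R}), (fun=> [tuple]).
  split=> [|f _ _]; first exact: measurable_cst.
  under eq_integral do rewrite big_ord0.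
  by rewrite big_ord0 integral_cst //= mul1e diracT.
exists _, (T * U)%type, (sigma_finite_product L M), (fun z => [tuple of z.1 :: p z.2]).
split=> [|f mf f0].
  by apply: measurable_cons => //; exact: measurableT_comp.
have mprod : measurable_fun [set: U] (fun u => \prod_(i < n) f i.+1 (tnth (p u) i)).
  apply: measurable_prod => i _.
  by apply: measurableT_comp => //; apply: (measurableT_comp (measurable_tnth i)).
pose F (z : T * U) := ((f 0%N z.1)%:E * (\prod_(i < n) f i.+1 (tnth (p z.2) i))%:E)%E.
have prod0 u : (0 <= (\prod_(i < n) f i.+1 (tnth (p u) i))%:E)%E.
  by rewrite lee_fin prodr_ge0.
transitivity (\int[sigma_finite_product L M]_z F z)%E.
  apply: eq_integral => z _; rewrite big_ord_recl /F -EFinM; congr (_ * _)%:E.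
  by apply: eq_bigr => i _; rewrite tnthS.
rewrite /sigma_finite_product fubini_tonelli1 //=; last 2 first.
- apply: emeasurable_funM; apply/measurable_EFinP.
    exact: (measurableT_comp (mf 0%N) measurable_fst).
  exact: (measurableT_comp mprod measurable_snd).
- by move=> z; rewrite mule_ge0 ?prod0 // lee_fin.
rewrite (eq_integral (fun y => (f 0%N y)%:E * \prod_(i < n) \int[L]_y (f i.+1 y)%:E)%E); last first.
  move=> y _; rewrite /fubini_F /F /= ge0_integralZl_EFin //; last exact/measurable_EFinP.
  by rewrite (pE _ (fun i => mf i.+1) (fun i => f0 i.+1)).
rewrite ge0_integralZr //=.
- by rewrite big_ord_recl.
- exact/measurable_EFinP.
- by move=> y _; rewrite lee_fin.
- by apply: prode_ge0 => i _; apply: integral_ge0 => y _; rewrite lee_fin.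
Qed.

End TupleMeasure.

(** * The joint law of states and observations *)

Section JointLaw.
Context (R : realType) (Y : completePseudoMetricType R)
  (L : {sigma_finite_measure set (borel Y) -> \bar R}) (J : nat)
  (theta : hmm_param L J) (d : measure_display) (Omega : measurableType d)
  (P : probability Omega R) (X : nat -> Omega -> 'I_J)
  (Yo : nat -> Omega -> borel Y) (hXY : is_hmm P theta X Yo).

Definition path_prob (x : nat -> 'I_J) n : R :=
  \prod_(i < n) (if i : nat is j.+1 then trans theta (x j) (x j.+1) else init theta 0 (x 0%N)).

Definition path_event (x : nat -> 'I_J) n : set Omega :=
  \bigcap_(i in `I_n) X i @^-1` [set x i].

Lemma path_prob_ge0 x n : 0 <= path_prob x n.
Proof.
by apply: prodr_ge0 => -[[|i] _] _ /=; [exact: init_ge0|exact: trans_ge0].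
Qed.

Lemma sigma_of_path x n : sigma_of X (path_event x n).
Proof.
rewrite /path_event; set G := [set B | exists i (S : set 'I_J), B = X i @^-1` S].
apply: (@bigcap_measurableType _ (g_sigma_algebraType G)) => i _.
by apply: sub_sigma_algebra; exists i, [set x i].
Qed.

Lemma measurable_path x n : measurable (path_event x n).
Proof. by apply: bigcap_measurableType => i _; exact: (hmm_measX hXY). Qed.

Lemma prob_path x n : P (path_event x n) = (path_prob x n)%:E.
Proof.
(* [hmm_markov] extends a nonempty history, so lengths 0 and 1 are both base cases. *)
rewrite /path_event /path_prob; elim: n => [|[|n] IH].
- by rewrite II0 bigcap_set0 probability_setT big_ord0.
- by rewrite II1 bigcap_set1 (hmm_init hXY) big_ord_recr big_ord0 /= mul1r.
- by rewrite (hmm_markov hXY) IH -EFinM [in RHS]big_ord_recr.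
Qed.

(** On the path event the product of emission laws is constant, so its integral is that constant
    times the probability of the path. *)
Lemma prob_path_obs x n (A : nat -> set (borel Y)) : (forall i, measurable (A i)) ->
  (P (path_event x n `&` \bigcap_(i in `I_n) Yo i @^-1` A i) =
  (path_prob x n)%:E * \prod_(i < n) emission theta (x i) (A i))%E.
Proof.
move=> mA; rewrite (hmm_cond hXY _ (sigma_of_path x n) mA).
rewrite (eq_integral (cst (\prod_(i < n) emission theta (x i) (A i)))%E); last first.
  move=> w /set_mem xw; apply: eq_bigr => i _; congr (emission theta _ _).
  exact: (xw i (ltn_ord i)).
by rewrite integral_cst /=; [rewrite muleC prob_path|exact: measurable_path].
Qed.

(** Joint density of states and observations; for fixed [y] it is the posterior law of the path up
    to normalisation. *)
Definition path_density n (x : nat -> 'I_J) (y : n.-tuple (borel Y)) : R :=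
  path_prob x n * \prod_(i < n) dens theta (x i) (tnth y i).

Lemma path_density_ge0 n x y : 0 <= @path_density n x y.
Proof.
by rewrite mulr_ge0 ?path_prob_ge0 // prodr_ge0 // => i _; exact: dens_ge0.
Qed.

Lemma measurable_path_density n x : measurable_fun setT (@path_density n x).
Proof.
apply: measurable_funM; first exact: measurable_cst.
apply: measurable_prod => i _.
exact: (measurableT_comp (dens_measurable theta (x i)) (measurable_tnth i)).
Qed.

Lemma measurable_observations n : measurable_fun setT (observations Yo n).
Proof.
apply/measurable_fun_tnthP => i; rewrite (_ : _ \o _ = Yo i); first exact: (hmm_measY hXY).
by apply/funext => w /=; rewrite tnth_mktuple.
Qed.

Section ProductSpace.
Context n (d' : measure_display) (U : measurableType d')
  (M : {sigma_finite_measure set U -> \bar R}) (p : U -> n.-tuple (borel Y)).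
Hypothesis mp : measurable_fun [set: U] p.
Hypothesis pE : forall f : nat -> borel Y -> R,
  (forall i, measurable_fun [set: borel Y] (f i)) -> (forall i y, 0 <= f i y) ->
  (\int[M]_u (\prod_(i < n) f i (tnth (p u) i))%:E
   = \prod_(i < n) \int[L]_y (f i y)%:E)%E.

Lemma measurable_path_density_comp x :
  measurable_fun [set: U] (fun u => path_density x (p u)).
Proof. exact: (measurableT_comp (measurable_path_density x) mp). Qed.

Lemma path_density_rectangle x (A : nat -> set (borel Y)) : (forall i, measurable (A i)) ->
  (\int[M]_(u in p @^-1` rectangle A) (path_density x (p u))%:E =
   (path_prob x n)%:E * \prod_(i < n) emission theta (x i) (A i))%E.
Proof.
move=> mA; pose f i y := dens theta (x i) y * \1_(A i) y.
have mf i : measurable_fun setT (f i).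
  by apply: measurable_funM; [exact: dens_measurable|exact: measurable_indic].
have f0 i y : 0 <= f i y by rewrite mulr_ge0 ?dens_ge0 // indicE.
have -> : (\prod_(i < n) emission theta (x i) (A i) = \prod_(i < n) \int[L]_y (f i y)%:E)%E.
  apply: eq_bigr => i _; rewrite /emission integral_mkcond; apply: eq_integral => y _.
  by rewrite epatch_indic /= EFinM.
rewrite -pE // integral_mkcond -ge0_integralZl_EFin ?path_prob_ge0 //; first last.
- apply/measurable_EFinP; apply: measurable_prod => i _.
  exact: (measurableT_comp (mf i) (measurableT_comp (measurable_tnth i) mp)).
- by move=> u _; rewrite lee_fin prodr_ge0.
apply: eq_integral => u _; rewrite epatch_indic /= -EFinM; congr _%:E.
rewrite /path_density big_split -mulrA; congr (_ * (_ * _)) => /=.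
rewrite indicE; case: (boolP (u \in _)) => [/set_mem uA|/negP uA].
  by rewrite big1 // => i _; rewrite indicE mem_set //; exact: uA.
apply/esym/eqP; rewrite prodf_seq_eq0; apply/hasP.
apply: contrapT => nA; apply: uA; apply/mem_set => i; apply: contrapT => nAi.
by apply: nA; exists i; rewrite ?mem_index_enum //= indicE memNset // eqxx.
Qed.

(** Both sides are finite measures in [A], written as image densities, and they agree on
    rectangles. *)
Lemma joint_density x (A : set (n.-tuple (borel Y))) : measurable A ->
  P (path_event x n `&` observations Yo n @^-1` A) =
  (\int[M]_(u in p @^-1` A) (path_density x (p u))%:E)%E.
Proof.
move=> mA; have mB := measurable_path x n.
have mw : measurable_fun setT (fun u => (path_density x (p u))%:E).
  by apply/measurable_EFinP; exact: measurable_path_density_comp.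
have w0 u : (0 <= (path_density x (p u))%:E)%E by rewrite lee_fin path_density_ge0.
have mI : measurable_fun setT (fun w => (\1_(path_event x n) w)%:E : \bar R).
  by apply/measurable_EFinP; exact: measurable_indic.
have I0 w : (0 <= (\1_(path_event x n) w)%:E :> \bar R)%E by rewrite lee_fin indicE.
pose m1 := image_density P (@measurable_observations n) mI I0.
pose m2 := image_density M mp mw w0.
have m1E B : measurable B -> m1 B = P (path_event x n `&` observations Yo n @^-1` B).
  move=> mB'; rewrite /m1 /image_density integral_indic //.
  by rewrite -[X in measurable X]setTI; exact: measurable_observations.
rewrite -m1E //; apply: (@tuple_measure_unique _ _ _ _ m1 m2) => // [B mB'|].
  apply: etrans (m1E _ (measurable_rectangle mB')) _.
  rewrite [RHS]path_density_rectangle // -prob_path_obs //; congr (P (_ `&` _)).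
  apply/seteqP; split=> w /= wB i; last by rewrite tnth_mktuple; exact: (wB i (ltn_ord i)).
  by move=> ni; have := wB (Ordinal ni); rewrite tnth_mktuple.
rewrite [X in (X < _)%E](m1E _ measurableT) preimage_setT setIT.
by rewrite (le_lt_trans (probability_le1 _ _)) ?ltry.
Qed.

Section ObservedExpectation.
Context (a0 : 'I_J) (F : finType) (g : n.-tuple (borel Y) -> F)
  (K : F -> n.-tuple 'I_J -> R).
Hypotheses (mg : measurable_to_fin g) (K0 : forall f t, 0 <= K f t).

(** Unnormalised posterior mean of the cost of the decision [g y]. The default [a0] extends a tuple
    beyond [n], where the density does not look. *)
Definition weighted_sum (y : n.-tuple (borel Y)) : R :=
  \sum_(t : n.-tuple 'I_J) path_density (nth a0 t) y * K (g y) t.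

Lemma weighted_sum_ge0 y : 0 <= weighted_sum y.
Proof. by apply: sumr_ge0 => t _; rewrite mulr_ge0 ?path_density_ge0. Qed.

(** Splitting by the finitely many values of [g] exhibits a finite sum of measurable terms. *)
Lemma weighted_sumE y : weighted_sum y = \sum_(ft : F * n.-tuple 'I_J)
  K ft.1 ft.2 * (path_density (nth a0 ft.2) y * \1_(g @^-1` [set ft.1]) y).
Proof.
rewrite -(pair_bigA _ (fun f t =>
  K f t * (path_density (nth a0 t) y * \1_(g @^-1` [set f]) y))) /=.
rewrite (bigD1 (g y)) //= [X in _ + X]big1 => [|f fg]; last first.
  rewrite big1 // => t _; rewrite indicE memNset ?mulr0 //= => gyf.
  by move: fg; rewrite gyf eqxx.
by rewrite addr0; apply: eq_bigr => t _; rewrite indicE mem_set // mulr1 mulrC.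
Qed.

Lemma measurable_weighted_sum : measurable_fun setT weighted_sum.
Proof.
rewrite (funext weighted_sumE); apply: measurable_sum => ft.
apply: measurable_funM => //; apply: measurable_funM.
  exact: measurable_path_density.
exact: measurable_indic.
Qed.

(** Reduces the comparison of two risks to a comparison at fixed observations. *)
Lemma expectation_observed :
  ('E_P[fun w => K (g (observations Yo n w)) [tuple X i w | i < n]]
   = \int[M]_u (weighted_sum (p u))%:E)%E.
Proof.
pose E (ft : F * n.-tuple 'I_J) :=
  path_event (nth a0 ft.2) n `&` observations Yo n @^-1` (g @^-1` [set ft.1]).
have mE ft : measurable (E ft).
  apply: measurableI; first exact: measurable_path.
  by rewrite -[X in measurable X]setTI; apply: measurable_observations => //; exact: mg.
have mgp f : measurable (p @^-1` (g @^-1` [set f])).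
  by rewrite -[X in measurable X]setTI; apply: mp => //; exact: mg.
have KE w : K (g (observations Yo n w)) [tuple X i w | i < n] =
    \sum_ft K ft.1 ft.2 * \1_(E ft) w.
  rewrite (bigD1 (g (observations Yo n w), [tuple X i w | i < n])) //=.
  rewrite indicE mem_set ?mulr1 => [|]; last first.
    by split=> // i ni; apply: etrans (tnth_nth a0 _ (Ordinal ni)); rewrite tnth_mktuple.
  rewrite big1 ?addr0 // => -[f t] /= ne; rewrite indicE memNset ?mulr0 // => -[] /= wt gf.
  move/eqP: ne; apply; congr pair => //; apply: eq_from_tnth => i.
  by rewrite tnth_mktuple (tnth_nth a0) (wt i (ltn_ord i)).
(* Both sides are sums over decisions and paths of [K] times the probability of [E], the right one
   by [joint_density]. *)
transitivity (\sum_(ft : F * n.-tuple 'I_J) (K ft.1 ft.2)%:E * P (E ft))%E.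
  rewrite unlock.
  rewrite (eq_integral (fun w => \sum_(ft : F * n.-tuple 'I_J)
    (K ft.1 ft.2)%:E * (\1_(E ft) w)%:E)%E).
    rewrite ge0_integral_sum //; first last.
    - by move=> ft w _; rewrite mule_ge0 // lee_fin ?K0 // indicE.
    - by move=> ft; apply: measurable_funeM; apply/measurable_EFinP; exact: measurable_indic.
    apply: eq_bigr => ft _; rewrite ge0_integralZl_EFin //.
    - by rewrite integral_indic // setIT.
    - by apply/measurable_EFinP; exact: measurable_indic.
  by move=> w _; rewrite KE -sumEFin; apply: eq_bigr => ft _; rewrite EFinM.
rewrite (eq_integral (fun u => \sum_(ft : F * n.-tuple 'I_J) (K ft.1 ft.2)%:E *
   ((path_density (nth a0 ft.2) (p u))%:E * (\1_(p @^-1` (g @^-1` [set ft.1])) u)%:E))%E).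
  have mw (ft : F * n.-tuple 'I_J) : measurable_fun setT (fun u =>
      (path_density (nth a0 ft.2) (p u))%:E *
      (\1_(p @^-1` (g @^-1` [set ft.1])) u)%:E)%E.
    apply: emeasurable_funM; apply/measurable_EFinP; first exact: measurable_path_density_comp.
    exact: measurable_indic.
  have w0 (ft : F * n.-tuple 'I_J) u : (0 <= (path_density (nth a0 ft.2) (p u))%:E *
      (\1_(p @^-1` (g @^-1` [set ft.1])) u)%:E)%E.
    by rewrite -EFinM lee_fin mulr_ge0 ?path_density_ge0.
  rewrite ge0_integral_sum //; first last.
  - by move=> ft u _; apply: mule_ge0 => //; rewrite lee_fin.
  - by move=> ft; exact: measurable_funeM.
  apply: eq_bigr => ft _; rewrite ge0_integralZl_EFin //; congr (_ * _)%E.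
  rewrite (joint_density (nth a0 ft.2) (mg [set ft.1])) [LHS]integral_mkcond.
  by apply: eq_integral => u _; rewrite epatch_indic.
move=> u _; rewrite weighted_sumE -sumEFin; apply: eq_bigr => ft _.
by rewrite EFinM EFinM.
Qed.

End ObservedExpectation.

End ProductSpace.
End JointLaw.

Lemma measurable_to_fin_tuple d (T : measurableType d) (F : finType) n
    (f : T -> n.-tuple F) :
  (forall i b, measurable [set y | tnth (f y) i = b]) -> measurable_to_fin f.
Proof.
move=> mf S.
rewrite (_ : f @^-1` S = \bigcup_(t in S) \bigcap_(i in [set: 'I_n]) [set y | tnth (f y) i = tnth t i]).
  apply: fin_bigcup_measurable => // t _.
  by apply: fin_bigcap_measurable => // i _; exact: mf.
apply/seteqP; split=> y /=; first by move=> Sy; exists (f y).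
by move=> [t St ft]; rewrite (_ : f y = t) //; apply: eq_from_tnth => i; exact: ft.
Qed.

(** * Risks *)

Section BayesRule.
Context (R : realType) (Y : completePseudoMetricType R)
  (L : {sigma_finite_measure set (borel Y) -> \bar R}) (theta : hmm_param L 2).

Let delta := min_trans theta.
Let odds := (1 - delta) / delta.

Lemma min_trans_le a b : delta <= trans theta a b.
Proof.
rewrite /delta /min_trans (bigD1 (a, b)) //= ge_min; apply/orP; left; exact: lexx.
Qed.

Lemma trans_sum2 a : trans theta a ord0 + trans theta a ord_max = 1.
Proof. by rewrite -(trans_sum1 theta a) big_ord2. Qed.

Lemma min_trans_half : 2 * delta <= 1.
Proof.
have := min_trans_le ord0 ord0; have := min_trans_le ord0 ord_max.
have := trans_sum2 ord0; lra.
Qed.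

Lemma trans_le a b : trans theta a b <= 1 - delta.
Proof.
have := trans_sum2 a; have := min_trans_le a ord0; have := min_trans_le a ord_max.
by move: b; apply: ord2_ind; lra.
Qed.

Lemma odds_ge1 : 0 < delta -> 1 <= odds.
Proof. by move=> d0; rewrite ler_pdivlMr //; have := min_trans_half; lra. Qed.

Section Observed.
Context n (y : n.-tuple (borel Y)).

(** Index 0 draws the first state from the initial law, so the start of the path sum is immaterial;
    the value 1 beyond the data keeps the kernel mixing at every index. *)
Definition hmm_kernel (i : nat) (a b : 'I_2) : R :=
  (if i is 0 then init theta 0 b else trans theta a b) *
  (if insub i is Some j then dens theta b (tnth y j) else 1).

(** The emission factor depends on [b] only. Transition entries lie between [delta] and [1 - delta],
    whose ratio is [odds]; at index 0 the kernel ignores the current state and [odds >= 1]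
    suffices. *)
Lemma mixing_hmm_kernel i : 0 < delta -> mixing odds (hmm_kernel i).
Proof.
move=> d0 a a' b; have c1 := odds_ge1 d0.
have e0 : 0 <= if insub i is Some j then dens theta b (tnth y j) else 1.
  by case: insub => // j; exact: dens_ge0.
rewrite /hmm_kernel; set e := (if insub i is Some _ then _ else _) in e0 *.
case: i @e e0 => [|i] e e0; (split; first by rewrite mulr_ge0 ?init_ge0 ?trans_ge0).
  by rewrite mulrA ler_wpM2r // ler_peMl ?init_ge0.
rewrite mulrA ler_wpM2r // (le_trans (trans_le a b)) //.
rewrite /odds mulrAC ler_pdivlMr // ler_wpM2l ?min_trans_le //.
by have := min_trans_half; lra.
Qed.

Lemma path_density_sum (F : seq 'I_2 -> R) :
  \sum_(t : n.-tuple 'I_2) path_density theta (nth ord0 t) y * F t =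
  path_sum n hmm_kernel F ord0.
Proof.
rewrite path_sumE; apply: eq_bigr => t _; congr (_ * _).
rewrite /path_density /path_prob -big_split; apply: eq_bigr => i _ /=.
rewrite /hmm_kernel valK; congr (_ * _).
by case: i => -[|i] lt_i.
Qed.

(** The normalising constant is common to both labels, so unnormalised errors may be compared. *)
Definition bayes_rule : n.-tuple 'I_2 :=
  [tuple if label_error hmm_kernel ord0 i ord0 <= label_error hmm_kernel ord0 i ord_max
         then ord0 else ord_max | i < n].

Lemma bayes_rule_error :
  \sum_(t : n.-tuple 'I_2) path_density theta (nth ord0 t) y *
    (n%:R^-1 * \sum_(i < n) (tnth bayes_rule i != tnth t i)%:R) =
  n%:R^-1 * \sum_(i < n) Num.min (label_error hmm_kernel ord0 i ord0)
                                 (label_error hmm_kernel ord0 i ord_max).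
Proof.
under eq_bigr => t _ do rewrite mulrCA mulr_sumr.
rewrite -mulr_sumr exchange_big; congr (_ * _); apply: eq_bigr => i _ /=.
transitivity (label_error hmm_kernel ord0 i (tnth bayes_rule i)).
  rewrite /label_error -path_density_sum; apply: eq_bigr => t _.
  by rewrite eq_sym (tnth_nth ord0).
by rewrite tnth_mktuple minEle; case: ifP.
Qed.

End Observed.

Lemma label_errorE n (y : n.-tuple (borel Y)) (i : 'I_n) b :
  label_error (hmm_kernel y) ord0 i b =
  \sum_(t : n.-tuple 'I_2) path_density theta (nth ord0 t) y * (tnth t i != b)%:R.
Proof.
rewrite /label_error -path_density_sum; apply: eq_bigr => t _.
by rewrite (tnth_nth ord0).
Qed.

Lemma measurable_bayes_rule n : measurable_to_fin (@bayes_rule n).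
Proof.
have mE (i : 'I_n) b : measurable_fun setT (fun y : n.-tuple (borel Y) =>
    label_error (hmm_kernel y) ord0 i b).
  rewrite (_ : (fun y => _) = (fun y : n.-tuple (borel Y) =>
    \sum_(t : n.-tuple 'I_2) path_density theta (nth ord0 t) y * (tnth t i != b)%:R)).
    apply: measurable_sum => t; apply: measurable_funM => //.
    exact: measurable_path_density.
  by apply/funext => y; exact: label_errorE.
apply: measurable_to_fin_tuple => i b.
pose C := [set y : n.-tuple (borel Y) |
  label_error (hmm_kernel y) ord0 i ord0 <= label_error (hmm_kernel y) ord0 i ord_max].
have mC : measurable C.
  rewrite (_ : C = (fun y : n.-tuple (borel Y) => label_error (hmm_kernel y) ord0 i ord_max -
     label_error (hmm_kernel y) ord0 i ord0) @^-1` `[0, +oo[).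
    rewrite -[X in measurable X]setTI; apply: measurable_funB => //; exact: measurable_itv.
  by apply/seteqP; split=> y; rewrite /C /= in_itv /= andbT subr_ge0.
move: b; apply: ord2_ind.
  rewrite (_ : [set y | _] = C) //; apply/seteqP; split=> y; rewrite /C /= tnth_mktuple; by case: ifP.
rewrite (_ : [set y | _] = ~` C); first exact: measurableC.
by apply/seteqP; split=> y; rewrite /C /= tnth_mktuple; case: ifP.
Qed.

End BayesRule.

Section Risks.
Context (R : realType) (Y : completePseudoMetricType R)
  (L : {sigma_finite_measure set (borel Y) -> \bar R}) (theta : hmm_param L 2)
  (d : measure_display) (Omega : measurableType d) (P : probability Omega R)
  (X : nat -> Omega -> 'I_2) (Yo : nat -> Omega -> borel Y)
  (hXY : is_hmm P theta X Yo) (n : nat) (n0 : (0 < n)%N).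

Definition tuple_loss (A : partitions n) (t : n.-tuple 'I_2) : R :=
  loss R (val A) (level_partition (tnth t)).

Definition tuple_errors (h t : n.-tuple 'I_2) : R :=
  n%:R^-1 * \sum_(i < n) (tnth h i != tnth t i)%:R.

Lemma tuple_loss_ge0 A t : 0 <= tuple_loss A t.
Proof. exact: loss_ge0 (valP A). Qed.

Lemma tuple_errors_ge0 h t : 0 <= tuple_errors h t.
Proof. by rewrite mulr_ge0 ?invr_ge0 // sumr_ge0. Qed.

Lemma risk_clustE (g : n.-tuple (borel Y) -> partitions n) :
  risk_clust P X Yo g =
  ('E_P[fun w => tuple_loss (g (observations Yo n w)) [tuple X i w | i < n]])%E.
Proof.
rewrite /risk_clust; congr expectation; apply/funext => w; congr loss.
by congr level_partition; apply/funext => i; rewrite tnth_mktuple.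
Qed.

Lemma risk_classE (h : n.-tuple (borel Y) -> n.-tuple 'I_2) :
  risk_class P X Yo h =
  ('E_P[fun w => tuple_errors (h (observations Yo n w)) [tuple X i w | i < n]])%E.
Proof.
rewrite /risk_class; congr expectation; apply/funext => w; congr (_ * _).
by apply: eq_bigr => i _; rewrite tnth_mktuple.
Qed.

Lemma inf_risk_clust_ge0 : (0 <= inf_risk_clust P X Yo n)%E.
Proof.
apply: le_ereal_inf_tmp => _ [g _ <-]; rewrite risk_clustE.
by apply: expectation_ge0 => w; exact: tuple_loss_ge0.
Qed.

Lemma inf_risk_class_ge0 : (0 <= inf_risk_class P X Yo n)%E.
Proof.
apply: le_ereal_inf_tmp => _ [h _ <-]; rewrite risk_classE.
by apply: expectation_ge0 => w; exact: tuple_errors_ge0.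
Qed.

Lemma inf_risk_clust_le_class :
  (inf_risk_clust P X Yo n <= inf_risk_class P X Yo n)%E.
Proof.
have [d' [U [M [p [mp pE]]]]] := product_measure_exists n L.
apply: le_ereal_inf_tmp => _ [h mh <-].
pose part (t : n.-tuple 'I_2) : partitions n :=
  exist (fun A => finset.partition A [set: 'I_n]%SET) _ (level_partitionP (tnth t)).
have mg : measurable_to_fin (part \o h) by move=> S; exact: (mh (part @^-1` S)).
apply: (@le_trans _ _ (risk_clust P X Yo (part \o h))).
  by apply: ereal_inf_lbound; exists (part \o h).
rewrite risk_clustE risk_classE.
rewrite (expectation_observed hXY mp pE ord0 mg tuple_loss_ge0).
rewrite (expectation_observed hXY mp pE ord0 mh tuple_errors_ge0).
apply: ge0_le_integral => //.
- by move=> u _; rewrite lee_fin; apply: weighted_sum_ge0; exact: tuple_loss_ge0.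
- by apply/measurable_EFinP;
  exact: (measurableT_comp (measurable_weighted_sum theta ord0 tuple_loss mg) mp).
- by apply/measurable_EFinP;
  exact: (measurableT_comp (measurable_weighted_sum theta ord0 tuple_errors mh) mp).
move=> u _; rewrite lee_fin ler_sum // => t _; rewrite ler_wpM2l ?path_density_ge0 //.
exact: loss_level_le.
Qed.

(** The inequality holds at every observation by [path_loss_ge] and is then integrated. *)
Lemma bayes_risk_le (alpha : R) (g : n.-tuple (borel Y) -> partitions n) :
  let c := (1 - min_trans theta) / min_trans theta in
  0 < min_trans theta -> 0 < alpha <= 1 -> 9 * c ^+ 10 <= alpha ^+ 2 * n%:R ->
  measurable_to_fin g ->
  ((1 - alpha)%:E * risk_class P X Yo (@bayes_rule _ _ _ theta n) <= risk_clust P X Yo g)%E.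
Proof.
move=> c d0 a01 cn mg; have [d' [U [M [p [mp pE]]]]] := product_measure_exists n L.
have mh : measurable_to_fin (@bayes_rule _ _ _ theta n) by exact: measurable_bayes_rule.
have a0 : 0 <= 1 - alpha by rewrite subr_ge0; case/andP: a01.
rewrite risk_clustE risk_classE.
rewrite (expectation_observed hXY mp pE ord0 mg tuple_loss_ge0).
rewrite (expectation_observed hXY mp pE ord0 mh tuple_errors_ge0).
have mW : measurable_fun setT (fun u => (weighted_sum theta ord0 (@bayes_rule _ _ _ theta n)
    tuple_errors (p u))%:E : \bar R).
  by apply/measurable_EFinP;
  exact: (measurableT_comp (measurable_weighted_sum theta ord0 tuple_errors mh) mp).
have W0 u : (0 <= (weighted_sum theta ord0 (@bayes_rule _ _ _ theta n)
    tuple_errors (p u))%:E :> \bar R)%E.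
  by rewrite lee_fin; apply: weighted_sum_ge0; exact: tuple_errors_ge0.
rewrite -ge0_integralZl_EFin //; apply: ge0_le_integral => //.
- by move=> u _; rewrite mule_ge0.
- exact: measurable_funeM.
- by apply/measurable_EFinP;
  exact: (measurableT_comp (measurable_weighted_sum theta ord0 tuple_loss mg) mp).
move=> u _; rewrite -EFinM lee_fin /weighted_sum [X in _ * X]bayes_rule_error.
have := path_loss_ge ord0 n0 (odds_ge1 d0) a01 cn
  (fun i => mixing_hmm_kernel (p u) i d0) (valP (g (p u))).
move=> /le_trans; apply; rewrite -path_density_sum; apply: ler_sum => t _.
rewrite /tuple_loss (_ : (fun i : 'I_n => nth ord0 t i) = tnth t) //.
by apply/funext => i; rewrite (tnth_nth ord0).
Qed.

End Risks.

Unset Implicit Arguments.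

Theorem theorem9 (R : realType) (Y : completePseudoMetricType R)
  (hY : polish_space Y)
  (L : {sigma_finite_measure set (borel Y) -> \bar R})
  (theta : hmm_param L 2) (htheta : Theta_dep theta)
  (hdelta : 0 < min_trans theta)
  (hinit : min_trans theta <= min_init theta)
  (d : measure_display) (Omega : measurableType d) (P : probability Omega R)
  (X : nat -> Omega -> 'I_2) (Yo : nat -> Omega -> borel Y)
  (hXY : is_hmm P theta X Yo)
  (n : nat) (hn : (1 <= n)%N) :
  ((1 - alpha_tilde (min_trans theta) n)%:E * inf_risk_class P X Yo n
     <= inf_risk_clust P X Yo n)%E
  /\ (inf_risk_clust P X Yo n <= inf_risk_class P X Yo n)%E.
Proof.
have d2 := min_trans_half theta.
split; last exact (inf_risk_clust_le_class hXY hn).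
have clust0 := inf_risk_clust_ge0 P X Yo hn.
have class0 := inf_risk_class_ge0 P X Yo n.
set alpha := alpha_tilde _ _.
have [a1|a1] := ltP 1 alpha.
  by apply: le_trans clust0; rewrite mule_le0_ge0 // lee_fin subr_le0 ltW.
have [a0 cn] := alpha_tilde_bound hdelta d2 hn a1.
apply: le_ereal_inf_tmp => _ [g mg <-].
apply: le_trans (bayes_risk_le hXY hn hdelta _ cn mg); last by rewrite a0.
(* The infimum over classifiers is at most the risk of the Bayes rule, and the factor [1 - alpha] is
   nonnegative. *)
rewrite lee_wpmul2l ?lee_fin ?subr_ge0 //; apply: ereal_inf_lbound.
by exists (@bayes_rule _ _ _ theta n) => //; exact: measurable_bayes_rule.
Qed.
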